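(* Let $S_1=\langle m_1,\dots,m_l\rangle$ and $S_2=\langle n_1,\dots,n_k\rangle$ be two numerical semigroups minimally generated by $m_1<\dots<m_l$ and $n_1<\dots<n_k$ respectively, and let $S=\langle qm_1,\dots,qm_l,pn_1,\dots,pn_k\rangle$ be a nice gluing of $S_1$ and $S_2$. If the associated monomial curves $C_1=C(m_1,\dots,m_l)$ and $C_2=C(n_1,\dots,n_k)$ have Cohen-Macaulay tangent cones at the origin, then $C=C(qm_1,\dots,qm_l,pn_1,\dots,pn_k)$ also has Cohen-Macaulay tangent cone at the origin, and thus the Hilbert function of the local ring $K[[t^{qm_1},\dots,t^{qm_l},t^{pn_1},\dots,t^{pn_k}]]$ is non-decreasing.
   Context: $K$ is an algebraically closed field. For positive integers $d_1,\dots,d_r$ with $\gcd(d_1,\dots,d_r)=1$, $\langle d_1,\dots,d_r\rangle=\{\sum_{i=1}^r a_id_i : a_i\in\mathbb{Z}_{\ge 0}\}$ is the numerical semigroup they generate; all numerical semigroups are taken with generators of gcd $1$. Monomial curves: if $d_1,\dots,d_r$ minimally generate a numerical semigroup, the affine monomial curve $C=C(d_1,\dots,d_r)\subset\mathbb{A}^r$ over $K$ is the curve with generic zero $(t^{d_1},\dots,t^{d_r})$; its defining ideal $I(C)\subset K[x_1,\dots,x_r]$ is the kernel of the $K$-algebra map $K[x_1,\dots,x_r]\to K[t]$, $x_i\mapsto t^{d_i}$. (For a glued curve $C(qm_1,\dots,qm_l,pn_1,\dots,pn_k)$ the generators are not required to be listed in increasing order.) Tangent cone: for a nonzero polynomial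 $f$, $f_*$ denotes its homogeneous summand of least degree, and $I(C)_*$ is the ideal generated by the $f_*$ for $0\ne f\in I(C)$. $I(C)_*$ is the defining ideal of the tangent cone of $C$ at the origin, and ''$C$ has Cohen-Macaulay tangent cone at the origin'' means that $K[x_1,\dots,x_r]/I(C)_*$ is a Cohen-Macaulay ring. Hilbert function: the local ring associated to $C$ is $R=K[[t^{d_1},\dots,t^{d_r}]]$ with maximal ideal $\mathfrak m$; its Hilbert function is $H_R(n)=\dim_K \mathfrak m^n/\mathfrak m^{n+1}$, $n\ge 0$, i.e. the Hilbert function of the associated graded ring $gr_{\mathfrak m}(R)\cong K[x_1,\dots,x_r]/I(C)_*$. It is non-decreasing if $H_R(n)\le H_R(n+1)$ for all $n\ge 0$. Gluing: let $S_1,S_2$ be numerical semigroups minimally generated by $m_1<\dots<m_l$ and $n_1<\dots<n_k$. Let $p=b_1m_1+\dots+b_lm_l\in S_1$ and $q=a_1n_1+\dots+a_kn_k\in S_2$ (with $a_i,b_j$ non-negative integers) be positive integers with $\gcd(p,q)=1$, $p\notin\{m_1,\dots,m_l\}$, $q\notin\{n_1,\dots,n_k\}$ and $\{qm_1,\dots,qm_l\}\cap\{pn_1,\dots,pn_k\}=\emptyset$. Then $S=\langle qm_1,\dots,qm_l,pn_1,\dots,pn_k\rangle$ is called a gluing of $S_1$ and $S_2$. It is called a nice gluing if moreover $p=b_1m_1+\dots+b_lm_l\in S_1$ and $q=a_1n_1\in S_2$ with $a_1\le b_1+\dots+b_l$. *)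

(* Defs.v *)
From HB Require Import structures.
From mathcomp Require Import all_boot all_order all_algebra.
From mathcomp Require Import boolp.
From mathcomp Require Import ring_quotient mpoly.
Set Implicit Arguments.
Unset Strict Implicit.
Unset Printing Implicit Defensive.
Import GRing.Theory.
Local Open Scope ring_scope.

Section CommutativeAlgebra.
Variable A : comNzRingType.
Implicit Types (I J P Q M : A -> Prop) (s : seq A).

Definition is_ideal I : Prop :=
  [/\ I 0, forall x y, I x -> I y -> I (x + y) & forall a x, I x -> I (a * x)].

Definition is_prime P : Prop :=
  [/\ is_ideal P, ~ P 1 & forall x y, P (x * y) -> P x \/ P y].

Definition is_maximal M : Prop :=
  [/\ is_ideal M, ~ M 1
    & forall J, is_ideal J -> ~ J 1 -> (forall x, M x -> J x) -> forall x, J x -> M x].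

Definition ideal_gen (G : A -> Prop) (x : A) : Prop :=
  exists2 s : seq (A * A),
    (forall u, u \in s -> G u.2) & x = \sum_(u <- s) u.1 * u.2.

Definition seq_ideal s : A -> Prop := ideal_gen (fun x => x \in s).

Definition is_noetherian : Prop :=
  forall I, is_ideal I -> exists s, forall x, I x <-> seq_ideal s x.

Definition regular_seq s : Prop :=
  ~ seq_ideal s 1 /\
  forall i, (i < size s)%N ->
    forall y, seq_ideal (take i s) (nth 0 s i * y) -> seq_ideal (take i s) y.

(* The depth (grade) of the ideal I on A: the largest length of a regular
   sequence contained in I. *)
Definition has_depth I (n : nat) : Prop :=
  (exists s, [/\ size s = n, forall x, x \in s -> I x & regular_seq s]) /\
  (forall s, (forall x, x \in s -> I x) -> regular_seq s -> (size s <= n)%N).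

(* P_0 < P_1 < ... < P_n <= P, a chain of n + 1 primes. *)
Definition prime_chain (P : A -> Prop) (n : nat) (C : nat -> A -> Prop) : Prop :=
  [/\ forall i, (i <= n)%N -> is_prime (C i),
      forall i, (i < n)%N ->
        (forall x, C i x -> C i.+1 x) /\ (exists2 x, C i.+1 x & ~ C i x)
    & forall x, C n x -> P x].

Definition has_height P (n : nat) : Prop :=
  (exists C, prime_chain P n C) /\
  (forall n' C, prime_chain P n' C -> (n' <= n)%N).

(* depth M = height M for every maximal ideal M; see Eisenbud, "Commutative
   Algebra", section 18.2. *)
Definition cohen_macaulay : Prop :=
  is_noetherian /\
  forall M, is_maximal M -> exists n, has_depth M n /\ has_height M n.

Definition ideal_mul I J (x : A) : Prop :=
  exists2 s : seq (A * A),
    (forall u, u \in s -> I u.1 /\ J u.2) & x = \sum_(u <- s) u.1 * u.2.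

Definition ideal_pow I (n : nat) : A -> Prop := iter n (ideal_mul I) (fun=> True).

(* When A is local, its maximal ideal. *)
Definition nonunits (x : A) : Prop := ~ exists y, x * y = 1.

End CommutativeAlgebra.

(* dim_K (V / W) = n for subspaces W of V of an ambient space E: some n elements
   of V form a basis modulo W. *)
Definition has_quotient_dim (K : fieldType) (E : lmodType K) (V W : E -> Prop)
    (n : nat) : Prop :=
  exists e : 'I_n -> E,
    [/\ forall i, V (e i),
        forall v, V v -> exists c : 'I_n -> K, W (v - \sum_i c i *: e i)
      & forall c : 'I_n -> K, W (\sum_i c i *: e i) -> forall i, c i = 0].

Definition hilbert_function (K : fieldType) (A : comAlgType K) (H : nat -> nat) : Prop :=
  forall n, has_quotient_dim (ideal_pow (@nonunits A) n)
                             (ideal_pow (@nonunits A) n.+1) (H n).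

(* Finiteness of every H_A(n) is part of the assertion. *)
Definition nondecreasing_hilbert_function (K : fieldType) (A : comAlgType K) : Prop :=
  exists2 H, hilbert_function A H & forall n, (H n <= H n.+1)%N.

Section Semigroups.
Variable r : nat.
Implicit Type d : 'I_r -> nat.
Local Open Scope nat_scope.

Definition in_semigroup d (n : nat) : Prop :=
  exists a : 'I_r -> nat, n = \sum_i a i * d i.

Definition minimal_generators d : Prop :=
  [/\ forall i, 0 < d i, \big[gcdn/0]_i d i = 1
    & forall i, ~ exists2 a : 'I_r -> nat, a i = 0 & d i = \sum_j a j * d j].

End Semigroups.

Section Gluing.
Variables (l k : nat) (m : 'I_l.+1 -> nat) (n : 'I_k.+1 -> nat) (p q : nat).
Local Open Scope nat_scope.

Definition glued (i : 'I_(l.+1 + k.+1)) : nat :=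
  match split i with inl j => q * m j | inr j => p * n j end.

Definition gluing : Prop :=
  [/\ in_semigroup m p /\ in_semigroup n q,
      [/\ 0 < p, 0 < q & coprime p q],
      (forall i, p <> m i) /\ (forall j, q <> n j)
    & forall i j, q * m i <> p * n j].

Definition nice_gluing : Prop :=
  gluing /\
  exists (b : 'I_l.+1 -> nat) (a1 : nat),
    [/\ p = \sum_i b i * m i, q = a1 * n ord0 & a1 <= \sum_i b i].

End Gluing.

Section TangentCone.
Variables (K : fieldType) (r : nat) (d : 'I_r -> nat).
Implicit Type f : {mpoly K[r]}.

Definition curve_map : {mpoly K[r]} -> {poly K} :=
  mmap (@polyC K) (fun i => 'X^(d i)).

Definition curve_ideal f : Prop := curve_map f = 0.

(* Every monomial m of f satisfies mdeg m < msize f, so this is the least degree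
   of a monomial of f when f <> 0. *)
Definition least_degree f : nat := \big[minn/msize f]_(m <- msupp f) mdeg m.

Definition initial_form f : {mpoly K[r]} := pihomog mdeg (least_degree f) f.

Definition tangent_cone_ideal : {mpoly K[r]} -> Prop :=
  ideal_gen (fun g => exists f, [/\ f <> 0, curve_ideal f & g = initial_form f]).

(* {ideal_quot _} requires a boolean predicate for a proper ideal, hence the
   positivity of the exponents. *)
Definition tangent_cone_pred (_ : forall i, (0 < d i)%N) (f : {mpoly K[r]}) : bool :=
  `[< tangent_cone_ideal f >].

Hypothesis d_gt0 : forall i, (0 < d i)%N.

Lemma curve_map_horner0 f : (curve_map f).[0] = f@_0%MM.
Proof.
have mono0 (m : 'X_{1..r}) :
    (mmap1 (fun i => 'X^(d i)) m : {poly K}).[0] = (m == 0%MM)%:R.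
  rewrite /mmap1 horner_prod; case: eqP => [->|m_neq0].
    by rewrite big1 // => i _; rewrite mnm0E expr0 hornerC.
  have [i mi_neq0] : exists i, m i != 0%N.
    apply/existsP; rewrite -negb_forall; apply/negP => /forallP m0.
    by apply: m_neq0; apply/mnmP => i; rewrite mnm0E; apply/eqP.
  apply/eqP; rewrite prodf_seq_eq0; apply/hasP; exists i.
    by rewrite mem_index_enum.
  by rewrite /= -exprM hornerXn expr0n muln_eq0 eqn0Ngt d_gt0 (negPf mi_neq0).
rewrite /curve_map /mmap horner_sum.
under eq_bigr => m _ do rewrite hornerCM mono0.
have [f0|f0] := boolP (0%MM \in msupp f).
  rewrite (bigD1_seq 0%MM) //= eqxx mulr1 big1 ?addr0 //.
  by move=> m /negPf ->; rewrite mulr0.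
rewrite (memN_msupp_eq0 f0) big_seq big1 // => m fm.
by case: eqP fm f0 => [-> ->|_ _ _]; rewrite ?mulr0.
Qed.

Lemma tangent_cone_ideal_coef0 f : tangent_cone_ideal f -> f@_0%MM = 0.
Proof.
case=> s sG ->; rewrite raddf_sum big_seq big1 //= => u /sG[g [_ g0 ->]].
rewrite rmorphM /= /initial_form pihomogE raddf_sum /= [X in _ * X]big1 ?mulr0 //.
move=> m _; rewrite mcoeffZ mcoeffX.
case: eqP => [->|_]; last by rewrite mulr0.
by rewrite -curve_map_horner0 g0 horner0 mul0r.
Qed.

Lemma tangent_cone_idealr : idealr_closed (tangent_cone_pred d_gt0).
Proof.
split.
- by apply/asboolP; exists [::]; rewrite ?big_nil.
- apply/asboolP => /tangent_cone_ideal_coef0 /eqP.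
  by rewrite mcoeff1 eqxx oner_eq0.
- move=> a f g /asboolP[s sG ->] /asboolP[t tG ->]; apply/asboolP.
  exists ([seq (a * u.1, u.2) | u <- s] ++ t).
    move=> u; rewrite mem_cat => /orP[/mapP[v vs ->]|]; [|exact: tG].
    exact: (sG v vs).
  rewrite big_cat big_map mulr_sumr /=; congr (_ + _).
  by apply: eq_bigr => u _; rewrite mulrA.
Qed.

HB.instance Definition _ :=
  isIdealr.Build {mpoly K[r]} (tangent_cone_pred d_gt0) tangent_cone_idealr.

(* K[x_1, ..., x_r] / I(C)_* *)
Definition tangent_cone_ring : comNzRingType :=
  {ideal_quot (tangent_cone_pred d_gt0 : idealr {mpoly K[r]})}.

End TangentCone.

Definition CM_tangent_cone (K : fieldType) (r : nat) (d : 'I_r -> nat) : Prop :=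
  exists d_gt0 : forall i, (0 < d i)%N, cohen_macaulay (tangent_cone_ring K d_gt0).

(* The formal power series ring K[[t]]: f n is the coefficient of t ^ n. *)
Definition fps (K : fieldType) : Type := nat -> K.

Section PowerSeries.
Variable K : fieldType.
Implicit Types f g h : fps K.

HB.instance Definition _ := Choice.copy (fps K) (nat -> K).

Definition fps_zero : fps K := fun=> 0.
Definition fps_opp f : fps K := fun n => - f n.
Definition fps_add f g : fps K := fun n => f n + g n.
Definition fps_one : fps K := fun n => (n == 0%N)%:R.
Definition fps_mul f g : fps K := fun n => \sum_(i < n.+1) f i * g (n - i)%N.
Definition fps_scale (c : K) f : fps K := fun n => c * f n.

Fact fps_addA : associative fps_add.
Proof. by move=> f g h; apply/funext => n; apply: addrA. Qed.
Fact fps_addC : commutative fps_add.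
Proof. by move=> f g; apply/funext => n; apply: addrC. Qed.
Fact fps_add0 : left_id fps_zero fps_add.
Proof. by move=> f; apply/funext => n; apply: add0r. Qed.
Fact fps_addN : left_inverse fps_zero fps_opp fps_add.
Proof. by move=> f; apply/funext => n; apply: addNr. Qed.

HB.instance Definition _ :=
  GRing.isZmodule.Build (fps K) fps_addA fps_addC fps_add0 fps_addN.

Fact fps_mulC : commutative fps_mul.
Proof.
move=> f g; apply/funext => n; rewrite /fps_mul (reindex_inj rev_ord_inj) /=.
by apply: eq_bigr => i _; rewrite subSS subKn ?leq_ord // mulrC.
Qed.

Fact fps_mulA : associative fps_mul.
Proof.
move=> f g h; apply/funext => n.
pose coef3 j k := f j * (g (n - j - k)%N * h k).
transitivity (\sum_(j < n.+1) \sum_(k < n.+1 | (k <= n - j)%N) coef3 j k).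
  apply: eq_bigr => /= j _; rewrite (fps_mulC g h) /fps_mul big_distrr /=.
  rewrite (big_ord_narrow_leq (leq_subr _ _)) /=.
  by apply: eq_bigr => i _; rewrite /coef3 [h _ * _]mulrC.
rewrite (fps_mulC _ h) /fps_mul (exchange_big_dep predT) //=.
apply: eq_bigr => k _; rewrite mulrC.
transitivity (\sum_(j < n.+1 | (j <= n - k)%N) coef3 j k).
  apply: eq_bigl => j; rewrite -ltnS -(ltnS j) -!subSn ?leq_ord //.
  by rewrite -subn_gt0 -(subn_gt0 j) -!subnDA addnC.
rewrite (big_ord_narrow_leq (leq_subr _ _)) big_distrl /=.
by apply: eq_bigr => j _; rewrite /coef3 -!subnDA addnC mulrA.
Qed.

Fact fps_mul1 : left_id fps_one fps_mul.
Proof.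
move=> f; apply/funext => n; rewrite /fps_mul big_ord_recl subn0 mul1r.
by rewrite big1 ?addr0 // => i _; rewrite mul0r.
Qed.

Fact fps_mulDl : left_distributive fps_mul fps_add.
Proof.
move=> f g h; apply/funext => n; rewrite /fps_mul /fps_add -big_split /=.
by apply: eq_bigr => i _; rewrite mulrDl.
Qed.

Fact fps_one_neq0 : fps_one != 0 :> fps K.
Proof.
apply/eqP => /(congr1 (fun f : fps K => f 0%N)).
by move/eqP; rewrite /fps_one eqxx oner_eq0.
Qed.

HB.instance Definition _ := GRing.Zmodule_isComNzRing.Build (fps K)
  fps_mulA fps_mulC fps_mul1 fps_mulDl fps_one_neq0.

Fact fps_scaleA a b f : fps_scale a (fps_scale b f) = fps_scale (a * b) f.
Proof. by apply/funext => n; apply: mulrA. Qed.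
Fact fps_scale1 : left_id 1 fps_scale.
Proof. by move=> f; apply/funext => n; apply: mul1r. Qed.
Fact fps_scaleDr : right_distributive fps_scale +%R.
Proof. by move=> a f g; apply/funext => n; apply: mulrDr. Qed.
Fact fps_scaleDl f : {morph fps_scale^~ f : a b / a + b}.
Proof. by move=> a b; apply/funext => n; apply: mulrDl. Qed.

HB.instance Definition _ := GRing.Zmodule_isLmodule.Build K (fps K)
  fps_scaleA fps_scale1 fps_scaleDr fps_scaleDl.

Fact fps_scaleAl (a : K) f g : a *: (f * g) = (a *: f) * g.
Proof.
apply/funext => n; rewrite /GRing.scale /GRing.mul /= /fps_scale /fps_mul.
by rewrite big_distrr; apply: eq_bigr => i _; apply: mulrA.
Qed.

HB.instance Definition _ := GRing.Lmodule_isLalgebra.Build K (fps K) fps_scaleAl.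
HB.instance Definition _ := GRing.Lalgebra_isComAlgebra.Build K (fps K).

End PowerSeries.

Section MonomialSeries.
Variables (K : fieldType) (r : nat) (d : 'I_r -> nat).

(* K[[t ^ d_1, ..., t ^ d_r]] consists of the series whose exponents lie in the
   semigroup generated by the d_i; see monomial_seriesP below. *)
Definition monomial_series_pred (f : fps K) : bool :=
  `[< forall n, f n != 0 -> in_semigroup d n >].

(* When all d_i > 0, these are the images of the series \sum_m c_m x ^ m of
   K[[x_1, ..., x_r]] under x_i |-> t ^ d_i; the degree of a monomial is then at
   most its weight n, so that the sum below runs over all monomials of weight n. *)
Lemma monomial_seriesP (f : fps K) : (forall i, (0 < d i)%N) ->
  monomial_series_pred f <->
  exists c : 'X_{1..r} -> K, forall n,
    f n = \sum_(m : 'X_{1..r < n.+1} | (\sum_i m i * d i)%N == n) c m.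
Proof.
move=> d_gt0; pose wt (m : 'X_{1..r}) := (\sum_i m i * d i)%N.
split=> [/asboolP fS|[c fE]]; last first.
  apply/asboolP => n; rewrite fE => /eqP sum_neq0.
  have [[m /eqP mn]|no_m] :=
    pselect (exists m : 'X_{1..r < n.+1}, (\sum_i m i * d i)%N == n).
    by exists (fun i => m i).
  by case: sum_neq0; rewrite big_pred0 // => m; apply/negP => mn; case: no_m; exists m.
have /choice[rep repP] : forall n, exists m, in_semigroup d n -> wt m = n.
  move=> n; have [[a ->]|nS] := pselect (in_semigroup d n); last by exists 0%MM.
  by exists [multinom a i | i < r] => _; apply: eq_bigr => i _; rewrite mnmE.
exists (fun m => if m == rep (wt m) then f (wt m) else 0) => n.
have [fn0|fn_neq0] := eqVneq (f n) 0.
  by rewrite fn0 big1 // => m /eqP mn; rewrite /wt mn fn0 if_same.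
have wt_n := repP n (fS n fn_neq0).
have deg_n : (mdeg (rep n) < n.+1)%N.
  rewrite ltnS -[leqRHS]wt_n mdegE; apply: leq_sum => i _.
  by rewrite leq_pmulr.
rewrite (bigD1 (BMultinom deg_n)) /=; last by apply/eqP.
rewrite wt_n eqxx big1 ?addr0 // => m /andP[/eqP mn m_neq].
rewrite /wt mn; case: eqP => // m_rep.
by move/eqP: m_neq; case; apply: val_inj.
Qed.

Lemma in_semigroup0 : in_semigroup d 0.
Proof. by exists (fun=> 0%N); rewrite big1. Qed.

Lemma in_semigroupD a b : in_semigroup d a -> in_semigroup d b -> in_semigroup d (a + b).
Proof.
move=> [u ->] [v ->]; exists (fun i => u i + v i)%N.
by rewrite -big_split; apply: eq_bigr => i _; rewrite mulnDl.
Qed.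

Lemma monomial_series_subalg : GRing.subsemialg_closed monomial_series_pred.
Proof.
split.
- apply/asboolP => n; rewrite /GRing.one /= /fps_one.
  by case: (n =P 0%N) => [-> _|_]; [exact: in_semigroup0|rewrite eqxx].
- split; first by apply/asboolP => n /eqP.
  move=> f g /asboolP fS /asboolP gS; apply/asboolP => n.
  have [fn0|fn _] := eqVneq (f n) 0; last exact: fS.
  rewrite /GRing.add /= /fps_add fn0 add0r; exact: gS.
- move=> a f /asboolP fS; apply/asboolP => n.
  by rewrite /GRing.scale /= /fps_scale mulf_eq0 negb_or => /andP[_ /fS].
- move=> f g /asboolP fS /asboolP gS; apply/asboolP => n.
  rewrite /GRing.mul /= /fps_mul => fg_neq0.
  have [i] : exists i : 'I_n.+1, f i * g (n - i)%N != 0.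
    apply/existsP; apply: contraNT fg_neq0 => /existsPn fg0.
    by rewrite big1 // => i _; apply/eqP; rewrite -[_ == _]negbK fg0.
  rewrite mulf_eq0 negb_or => /andP[/fS Si /gS Sj].
  by rewrite -(subnKC (leq_ord i)); exact: in_semigroupD.
Qed.

Record monomial_series : Type := MonomialSeries {
  series_of : fps K;
  _ : monomial_series_pred series_of
}.

HB.instance Definition _ := [isSub for series_of].
HB.instance Definition _ := [Choice of monomial_series by <:].
HB.instance Definition _ :=
  GRing.isSubalgClosed.Build K (fps K) monomial_series_pred monomial_series_subalg.
HB.instance Definition _ := [SubChoice_isSubComNzRing of monomial_series by <:].
HB.instance Definition _ := [SubZmodule_isSubLmodule of monomial_series by <:].
HB.instance Definition _ :=
  [SubNzRing_SubLmodule_isSubLalgebra of monomial_series by <:].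
HB.instance Definition _ := [SubLalgebra_isSubAlgebra of monomial_series by <:].

End MonomialSeries.

(* Main.v *)
(* In the tangent cone ring T = K[x]/I(C)_* the classes of the monomials x^a, with
   a a longest factorization of its weight s, form a basis t^s indexed by the
   semigroup S, and t^s t^u is t^(s+u) if ord(s) + ord(u) = ord(s+u), and 0
   otherwise. If d_1 is the strict minimum of the generators, every other x_i is
   nilpotent in T, so the reduction of T is K[x_1] and Spec T is a line; it
   follows that T is Cohen-Macaulay iff x_1 is regular, i.e. iff
   ord(s + d_1) = ord(s) + 1 for all s in S. The latter condition is inherited by
   a nice gluing: if v is in the Apery set of S_2 with respect to q, then
   ord(q u + p v) = ord_1(u) + ord_2(v). Finally H_R(n) is the number of elements
   of S of order n, so that s |-> s + d_1 shows that H_R is non-decreasing. *)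

Require Import Defs.
From HB Require Import structures.
From mathcomp Require Import all_boot all_order all_algebra.
From mathcomp Require Import boolp ring_quotient mpoly ring zify.

Set Implicit Arguments.
Unset Strict Implicit.
Unset Printing Implicit Defensive.

Import GRing.Theory.
Local Open Scope ring_scope.

(** * Ideals and modules over K[X] *)

Section Ideals.
Variable A : comNzRingType.
Implicit Types (I J P M : A -> Prop) (s : seq A) (x y z : A).

Lemma idealN I x : is_ideal I -> I x -> I (- x).
Proof. by case=> _ _ IM Ix; rewrite -mulN1r; exact: IM. Qed.

Lemma idealB I x y : is_ideal I -> I x -> I y -> I (x - y).
Proof. by move=> idI Ix Iy; have [_ ID _] := idI; apply: ID => //; exact: idealN. Qed.

Lemma ideal_subr I x y : is_ideal I -> I (x - y) -> I x <-> I y.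
Proof.
move=> idI Ixy; have [_ ID _] := idI.
split=> [Ix|Iy]; last by rewrite -(subrK y x); exact: ID.
by rewrite -(subKr x y); exact: idealB.
Qed.

Lemma is_ideal_gen (G : A -> Prop) : is_ideal (ideal_gen G).
Proof.
split.
- by exists [::]; rewrite ?big_nil.
- move=> _ _ [s sG ->] [t tG ->]; exists (s ++ t); last by rewrite big_cat.
  by move=> u; rewrite mem_cat => /orP[/sG|/tG].
- move=> a _ [s sG ->]; exists [seq (a * u.1, u.2) | u <- s].
    by move=> _ /mapP[v /sG Gv ->].
  by rewrite big_map mulr_sumr; apply: eq_bigr => u _; rewrite mulrA.
Qed.

Lemma ideal_gen_sub (G : A -> Prop) I x :
  is_ideal I -> (forall g, G g -> I g) -> ideal_gen G x -> I x.
Proof.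
case=> I0 ID IM GI [s sG ->]; rewrite big_seq; elim/big_ind: _ => // u us.
by apply: IM; apply: GI; exact: sG.
Qed.

Lemma mem_ideal_gen (G : A -> Prop) x : G x -> ideal_gen G x.
Proof.
by move=> Gx; exists [:: (1, x)]; rewrite ?big_seq1 ?mul1r // => u; rewrite inE => /eqP->.
Qed.

Lemma is_ideal_zero : is_ideal (fun x : A => x = 0).
Proof. by split=> // [x y -> ->|a x ->]; rewrite ?addr0 ?mulr0. Qed.

Lemma is_ideal_span1 y : is_ideal (fun x => exists a, x = a * y).
Proof.
split; first by exists 0; rewrite mul0r.
  by move=> _ _ [a ->] [b ->]; exists (a + b); rewrite mulrDl.
by move=> a _ [b ->]; exists (a * b); rewrite mulrA.
Qed.

Lemma is_prime_ker (B : idomainType) (f : {rmorphism A -> B}) :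
  is_prime (fun x => f x = 0).
Proof.
split; first split=> [|x y fx fy|a x fx];
  rewrite ?rmorph0 ?rmorphD ?rmorphM /= ?fx ?fy ?addr0 ?mulr0 //.
  by rewrite rmorph1; apply/eqP/oner_neq0.
by move=> x y; rewrite rmorphM => /eqP; rewrite mulf_eq0 => /orP[]/eqP; [left|right].
Qed.

Lemma seq_ideal_nil x : seq_ideal [::] x <-> x = 0.
Proof.
split=> [|->]; last by case: (is_ideal_gen (fun x => x \in [::])).
exact: (ideal_gen_sub is_ideal_zero).
Qed.

Lemma seq_ideal1 y x : seq_ideal [:: y] x <-> exists a, x = a * y.
Proof.
split=> [|[a ->]].
  apply: (ideal_gen_sub (is_ideal_span1 y)) => g.
  by rewrite inE => /eqP->; exists 1; rewrite mul1r.
case: (is_ideal_gen (fun x => x \in [:: y])) => _ _; apply.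
by apply: mem_ideal_gen; rewrite mem_head.
Qed.

Lemma prime_expr P x n : is_prime P -> P (x ^+ n) -> P x.
Proof.
case=> _ P1 PM; elim: n => [|n IH]; first by rewrite expr0 => /P1.
by rewrite exprS => /PM[].
Qed.

Lemma prime_nilp P x : is_prime P -> (exists n, x ^+ n = 0) -> P x.
Proof.
by move=> prP [n xn]; apply: (prime_expr (n := n) prP); rewrite xn; case: prP => -[].
Qed.

Lemma maximal_prime M : is_maximal M -> is_prime M.
Proof.
move=> [idM M1 maxM]; split=> // x y Mxy; case: (pselect (M x)) => Mx; [by left|right].
have [M0 MD MM] := idM.
pose J z := exists a v, M v /\ z = v + a * x.
have idJ : is_ideal J.
  split; first by exists 0, 0; rewrite mul0r addr0.
    move=> _ _ [a [u [Mu ->]]] [b [v [Mv ->]]]; exists (a + b), (u + v).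
    by split; [exact: MD|ring].
  by move=> c _ [a [u [Mu ->]]]; exists (c * a), (c * u); split; [exact: MM|ring].
have JM z : M z -> J z by move=> Mz; exists 0, z; split=> //; ring.
case: (pselect (J 1)) => [[a [u [Mu /(congr1 ( *%R^~ y))]]]|J1].
  rewrite mul1r => ->; rewrite mulrDl -mulrA; apply: MD; last exact: MM.
  by rewrite mulrC; exact: MM.
by case: Mx; apply: (maxM J idJ J1 JM); exists 1, 0; split=> //; ring.
Qed.

(** Treats the elements of [s] one at a time: multiplying by the largest power of [x] that stays
    outside [I] makes [x] kill the result modulo [I], and what was killed before stays killed. *)
Lemma ideal_socle I z s : is_ideal I -> ~ I z ->
    (forall x, x \in s -> exists n, I (x ^+ n * z)) ->
  exists w, ~ I (w * z) /\ forall x, x \in s -> I (x * (w * z)).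
Proof.
move=> idI Iz; have [_ _ IM] := idI.
elim: s => [|x s IH] sn; first by exists 1; rewrite mul1r.
have [|w [Iwz ws]] := IH; first by move=> y ys; apply: sn; rewrite inE ys orbT.
have [n xn] := sn x (mem_head _ _).
have ex : exists n, `[< I (x ^+ n * (w * z)) >].
  by exists n; apply/asboolP; rewrite mulrCA; exact: IM.
case: (ex_minnP ex) => -[|j] /asboolP xj jmin; first by rewrite mul1r in xj.
exists (x ^+ j * w); split=> [Ij|y].
  suff: (j < j)%N by rewrite ltnn.
  by apply: jmin; apply/asboolP; rewrite mulrA.
rewrite inE -!mulrA => /orP[/eqP->|ys]; first by rewrite mulrA -exprS.
by rewrite mulrCA; apply: IM; exact: ws.
Qed.

Lemma seq_ideal_kills I w s y : is_ideal I -> (forall x, x \in s -> I (x * w)) ->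
  seq_ideal s y -> I (y * w).
Proof.
case=> I0 ID IM sw; apply: (@ideal_gen_sub _ (fun y => I (y * w))) => //.
by split=> [|x z Ix Iz|a x Ix]; rewrite ?mul0r ?mulrDl -?mulrA //; [exact: ID|exact: IM].
Qed.

End Ideals.

(** * Submodules of finitely generated [{poly K}]-modules *)

Section PolynomialModule.
Variables (K : fieldType) (A : comNzRingType) (rho : {rmorphism {poly K} -> A}).
Implicit Types (s e : seq A) (I : A -> Prop).

Lemma poly_ideal_principal (J : {poly K} -> Prop) : is_ideal J ->
  exists2 g, J g & forall f, J f -> exists h, f = h * g.
Proof.
move=> idJ; have [J0 _ JM] := idJ.
case: (pselect (exists2 f, J f & f != 0)) => [[f Jf f0]|nJ]; last first.
  exists 0 => // f Jf; exists 0; rewrite mul0r; apply/eqP/negPn/negP => f0.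
  by apply: nJ; exists f.
have ex : exists n, `[< exists2 f, J f & f != 0 /\ size f = n >].
  by exists (size f); apply/asboolP; exists f.
case: (ex_minnP ex) => n /asboolP[g Jg [g0 <-]] gmin; exists g => // h Jh.
exists (h %/ g); apply/eqP; rewrite -subr_eq0; apply/negPn/negP => r0.
have rE : h - h %/ g * g = h %% g by rewrite [X in X - _](divp_eq h g) addrC addKr.
have := gmin (size (h %% g)); rewrite leqNgt ltn_modp g0 => /(_ _)/negP[]//.
by apply/asboolP; exists (h %% g); rewrite -rE //; apply: idealB => //; exact: JM.
Qed.

(** Spelled out one generator at a time, so that an induction on [e] can clear the coefficient of
    its head. *)
Fixpoint poly_span e (x : A) : Prop :=
  if e is y :: e' then exists c : {poly K}, poly_span e' (x - rho c * y) else x = 0.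

Lemma poly_span0 e : poly_span e 0.
Proof. by elim: e => //= y e IH; exists 0; rewrite rmorph0 mul0r subr0. Qed.

Lemma poly_spanD e x y : poly_span e x -> poly_span e y -> poly_span e (x + y).
Proof.
elim: e x y => [|z e IH] x y /=; first by move=> -> ->; rewrite addr0.
move=> [b xb] [c yc]; exists (b + c); have -> : x + y - rho (b + c) * z =
  (x - rho b * z) + (y - rho c * z) by rewrite rmorphD /=; ring.
exact: IH.
Qed.

Lemma poly_spanZ e c x : poly_span e x -> poly_span e (rho c * x).
Proof.
elim: e x => [|z e IH] x /=; first by move=> ->; rewrite mulr0.
move=> [b xb]; exists (c * b); have -> : rho c * x - rho (c * b) * z =
  rho c * (x - rho b * z) by rewrite rmorphM /=; ring.
exact: IH.
Qed.

Lemma poly_spanB e x y : poly_span e x -> poly_span e y -> poly_span e (x - y).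
Proof.
move=> xe ye; apply: poly_spanD => //.
by have := poly_spanZ (-1) ye; rewrite rmorphN1 mulN1r.
Qed.

Lemma poly_span_mem e x : x \in e -> poly_span e x.
Proof.
elim: e => //= y e IH; rewrite inE => /orP[/eqP->|/IH xe]; last first.
  by exists 0; rewrite rmorph0 mul0r subr0.
by exists 1; rewrite rmorph1 mul1r subrr; exact: poly_span0.
Qed.

(** The possible coefficients of elements of [I] at the head of [e] form a principal ideal. Once its
    generator is lifted to [x0] in [I], subtracting a multiple of [x0] moves any element of [I] into
    the span of the tail. *)
Lemma poly_submodule_fg e I : I 0 -> (forall x y, I x -> I y -> I (x + y)) ->
    (forall c x, I x -> I (rho c * x)) -> (forall x, I x -> poly_span e x) ->
  exists2 s, (forall x, x \in s -> I x) & (forall x, I x -> poly_span s x).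
Proof.
elim: e I => [|y e IH] I I0 ID IZ Ie; first by exists [::].
have IB x z : I x -> I z -> I (x - z).
  by move=> Ix Iz; apply: ID => //; rewrite -mulN1r -(rmorphN1 rho); exact: IZ.
pose J c := exists2 x, I x & poly_span e (x - rho c * y).
have [|g [x0 Ix0 x0e] gJ] := @poly_ideal_principal J.
  split; first by exists 0 => //; rewrite rmorph0 mul0r subr0; exact: poly_span0.
    move=> b c [x Ix xb] [z Iz zc]; exists (x + z); first exact: ID.
    have -> : x + z - rho (b + c) * y = (x - rho b * y) + (z - rho c * y).
      by rewrite rmorphD /=; ring.
    exact: poly_spanD.
  move=> a c [x Ix xc]; exists (rho a * x); first exact: IZ.
  have -> : rho a * x - rho (a * c) * y = rho a * (x - rho c * y).
    by rewrite rmorphM /=; ring.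
  exact: poly_spanZ.
have [||||s sI Is] := IH (fun x => I x /\ poly_span e x);
  first by split=> //; exact: poly_span0.
- by move=> x z [? ?] [? ?]; split; [exact: ID|exact: poly_spanD].
- by move=> c x [? ?]; split; [exact: IZ|exact: poly_spanZ].
- by move=> x [].
exists (x0 :: s) => [x|x Ix]; first by rewrite inE => /orP[/eqP->|/sI[]].
have /= [c xc] := Ie x Ix; have [|h ch] := gJ c; first by exists x.
exists h; apply: Is; split; first by apply: IB => //; exact: IZ.
have -> : x - rho h * x0 = (x - rho c * y) - rho h * (x0 - rho g * y).
  by rewrite ch rmorphM /=; ring.
by apply: poly_spanB => //; exact: poly_spanZ.
Qed.

(** An ideal is a [{poly K}]-submodule, and generators of it as a module also generate it as an
    ideal. *)
Lemma poly_span_noetherian e : (forall x, poly_span e x) -> is_noetherian A.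
Proof.
move=> eA I [I0 ID IM]; have [s sI Is] :
    exists2 s, (forall x, x \in s -> I x) & (forall x, I x -> poly_span s x).
  by apply: (@poly_submodule_fg e I) => // c x; exact: IM.
exists s => x; split=> [Ix|]; last by apply: ideal_gen_sub.
have [_ sD sM] := is_ideal_gen (fun x => x \in s).
suff sub t y : {subset t <= s} -> poly_span t y -> seq_ideal s y.
  by apply: (sub s) => //; exact: Is.
elim: t y => [|z t IH] y ts /=; first by move=> ->; case: (is_ideal_gen (fun x => x \in s)).
move=> [c yc]; rewrite -(subrK (rho c * z) y); apply: sD.
  by apply: IH => // u ut; apply: ts; rewrite inE ut orbT.
by apply: sM; apply: mem_ideal_gen; apply: ts; rewrite mem_head.
Qed.

End PolynomialModule.

(** * Rings whose reduction is K[X] *)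

Section ThickLine.
Variables (K : closedFieldType) (A : comNzRingType).
Variables (rho : {rmorphism {poly K} -> A}) (eps : {rmorphism A -> {poly K}}).
Variable xs : seq A.
Hypothesis rhoK : cancel rho eps.
Hypothesis xs_nil : forall x, x \in xs -> exists n, x ^+ n = 0.
Hypothesis eps_ker : forall a, seq_ideal xs (a - rho (eps a)).

Implicit Types (I J P M : A -> Prop) (s : seq A) (x y z : A).

(** Every prime contains the nilpotents [xs], so the primes of [A] come from [{poly K}] through
    [eps]: [point c] lies over the ideal of X - c, and [generic] over zero. *)
Let point c (y : A) : Prop := (eps y).[c] = 0.
Let generic (y : A) : Prop := eps y = 0.

Lemma is_prime_point c : is_prime (point c).
Proof. exact: (is_prime_ker (horner_eval c \o eps)). Qed.

Lemma is_prime_generic : is_prime generic.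
Proof. exact: is_prime_ker. Qed.

Lemma eps_rhoX c : (eps (rho ('X - c%:P))).[c] = 0.
Proof. by rewrite rhoK hornerXsubC subrr. Qed.

Lemma ideal_unit I a : is_ideal I -> I (rho a%:P) -> a != 0 -> I 1.
Proof.
case=> _ _ IM Ia a0; rewrite -(rmorph1 rho) -polyC1 -(mulVf a0) polyCM rmorphM.
exact: IM.
Qed.

Lemma prime_ker P y : is_prime P -> P y <-> P (rho (eps y)).
Proof.
move=> prP; have [idP _ _] := prP; apply: ideal_subr => //.
by apply: ideal_gen_sub (eps_ker y) => // x /xs_nil; exact: prime_nilp.
Qed.

(** Modulo [P] the element [y] equals the constant (eps y)(c), which is a unit unless it
    vanishes. *)
Lemma prime_point_sub P c y : is_prime P -> P (rho ('X - c%:P)) -> P y <-> point c y.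
Proof.
move=> prP Pc; have [idP P1 _] := prP; have [_ _ PM] := idP; rewrite prime_ker // /point.
have /factor_theorem[h hE] : root (eps y - (eps y).[c]%:P) c.
  by rewrite rootE !hornerE subrr.
have Pdiff : P (rho (eps y) - rho (eps y).[c]%:P).
  by rewrite -rmorphB hE rmorphM /=; exact: PM.
rewrite (ideal_subr idP Pdiff).
split=> [Py|->]; last by rewrite rmorph0; case: idP.
by apply/eqP/negPn/negP; move/(ideal_unit idP Py).
Qed.

(** As [K] is algebraically closed, [eps y] splits into linear factors, one of which falls into
    [P]. *)
Lemma prime_has_point P y : is_prime P -> P y -> eps y != 0 ->
  exists c, P (rho ('X - c%:P)).
Proof.
move=> prP Py y0; have [idP P1 PP] := prP.
move: Py; rewrite prime_ker //; have [r ->] := closed_field_poly_normal (eps y).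
rewrite -mul_polyC rmorphM /= => /PP[Pl|].
  by case: P1; apply: (ideal_unit idP Pl); rewrite lead_coef_eq0.
elim: r => [|c r IH]; first by rewrite big_nil rmorph1 => /P1.
by rewrite big_cons rmorphM /= => /PP[Pc|]; [exists c|].
Qed.

Lemma maximal_point M : is_maximal M -> exists c, forall y, M y <-> point c y.
Proof.
move=> maxM; have prM := maximal_prime maxM; have [idM M1 Mmax] := maxM.
case: (pselect (exists2 y, M y & eps y != 0)) => [[y My y0]|nM].
  by have [c Mc] := prime_has_point prM My y0; exists c => z; exact: prime_point_sub.
(* Here [M] is contained in [generic], hence in every [point c]; the choice of 0 is arbitrary, and
   maximality gives equality. *)
exists 0 => y; split=> [My|].
  rewrite /point; suff -> : eps y = 0 by rewrite horner0.
  by apply/eqP/negPn/negP => y0; apply: nM; exists y.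
have [idp p1 _] := is_prime_point 0; apply: Mmax => // x Mx.
rewrite /point; suff -> : eps x = 0 by rewrite horner0.
by apply/eqP/negPn/negP => y0; apply: nM; exists x.
Qed.

Lemma is_maximal_point c : is_maximal (point c).
Proof.
have [idp p1 _] := is_prime_point c; split=> // J idJ J1 pJ x Jx.
have [J0 JD JM] := idJ.
have Jc : J (rho (eps x).[c]%:P).
  by apply/(@ideal_subr _ J x) => //; apply: pJ; rewrite /point !(rmorphB, rhoK, hornerE) subrr.
by apply/eqP/negPn/negP; move/(ideal_unit idJ Jc).
Qed.

Lemma maximal_height1 M : is_maximal M -> has_height M 1.
Proof.
move=> maxM; have [c Mc] := maximal_point maxM; split.
  exists (fun i => if i == 0%N then generic else point c); split.
  - by move=> [|[|i]] //= _; [exact: is_prime_generic|exact: is_prime_point].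
  - move=> [|i] //= _; split; first by move=> x; rewrite /generic /point => ->; rewrite horner0.
    exists (rho ('X - c%:P)); first exact: eps_rhoX.
    by rewrite /generic rhoK => /eqP; rewrite polyXsubC_eq0.
  - by move=> x /= /Mc.
(* An element of [C 1] outside [C 0] is not killed by [eps], so [C 1] contains some X - c. Then
   [C 1] and [C 2] both coincide with [point c], against strictness. *)
move=> n C [prC sC _]; rewrite leqNgt; apply/negP => n2.
have [|_ [y C1y C0y]] := sC 0%N; first by lia.
have pr1 : is_prime (C 1%N) by apply: prC; lia.
have pr2 : is_prime (C 2%N) by apply: prC; lia.
have y0 : eps y != 0.
  apply/eqP => y0; have pr0 : is_prime (C 0%N) by exact: prC.
  by apply: C0y; rewrite (prime_ker _ pr0) y0 rmorph0; case: pr0 => -[].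
have [b C1b] := prime_has_point pr1 C1y y0.
have [|sub [z C2z C1z]] := sC 1%N; first by lia.
by apply: C1z; apply/(prime_point_sub z pr1 C1b)/(prime_point_sub z pr2 (sub _ C1b)).
Qed.

(** If [eps y] vanished, [y] would lie in the ideal of [xs] and kill a nonzero [w] annihilated by
    all of [xs]. *)
Lemma eps_regular y : (forall z, y * z = 0 -> z = 0) -> eps y != 0.
Proof.
move=> yreg; apply/eqP => y0.
have [w [w0 ws]] : exists w, ~ w * 1 = 0 /\ forall x, x \in xs -> x * (w * 1) = 0.
  apply: (@ideal_socle _ (fun x => x = 0)); first exact: is_ideal_zero.
    exact/eqP/oner_neq0.
  by move=> x /xs_nil[n xn]; exists n; rewrite mulr1.
apply: w0; apply: yreg; apply: (seq_ideal_kills (@is_ideal_zero A) ws).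
by rewrite -[y]subr0 -(rmorph0 rho) -y0; exact: eps_ker.
Qed.

Lemma point_gen c y : point c y -> seq_ideal (rho ('X - c%:P) :: xs) y.
Proof.
move=> /eqP/factor_theorem[h yE].
have [_ sD sM] := is_ideal_gen (fun x => x \in rho ('X - c%:P) :: xs).
rewrite -(subrK (rho (eps y)) y); apply: sD; last first.
  by rewrite yE rmorphM; apply: sM; apply: mem_ideal_gen; rewrite mem_head.
apply: ideal_gen_sub (eps_ker y); first exact: is_ideal_gen.
by move=> x xs_x; apply: mem_ideal_gen; rewrite inE xs_x orbT.
Qed.

(* Modulo a regular y1 the local ring at the point c is Artinian, so its socle
   is killed by every y2 vanishing at c. *)
Lemma regular_seq_size c s : (forall x, x \in s -> point c x) -> regular_seq s ->
  (size s <= 1)%N.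
Proof.
case: s => [|y1 [|y2 s]] //= sc [_ reg]; exfalso.
have y1c : point c y1 by apply: sc; rewrite mem_head.
have y2c : point c y2 by apply: sc; rewrite !inE eqxx orbT.
have y1reg z : y1 * z = 0 -> z = 0.
  by move=> yz; apply/seq_ideal_nil; apply: (reg 0%N) => //; apply/seq_ideal_nil.
pose I z := exists a, z = a * y1.
have idI : is_ideal I by exact: is_ideal_span1.
have [I0 ID IM] := idI.
have y2reg z : I (y2 * z) -> I z.
  by move=> Iz; apply/seq_ideal1; apply: (reg 1%N) => //; apply/seq_ideal1.
have e0 := eps_regular y1reg; set g := eps y1 in e0.
(* Modulo [y1], [rho g] is the opposite of [y1 - rho g], which is nilpotent because it lies in the
   ideal of [xs]. *)
have gE : exists N, I (rho g ^+ N).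
  have : seq_ideal xs (y1 - rho g) by exact: eps_ker.
  suff nilN u : seq_ideal xs u -> exists n, u ^+ n = 0.
    move=> /nilN[N uN]; exists N.
    have -> : rho g = y1 - (y1 - rho g) by ring.
    move: (y1 - rho g) uN => u uN.
    have : I ((y1 - u) ^+ N - (- u) ^+ N).
      rewrite subrXX; have -> : y1 - u - - u = y1 by ring.
      by rewrite mulrC; exists (\sum_(i < N) (y1 - u) ^+ (N.-1 - i) * (- u) ^+ i).
    by rewrite exprNn uN mulr0 subr0.
  apply: (@ideal_gen_sub _ _ (fun u => exists n, u ^+ n = 0)); last exact: xs_nil.
  split; first by exists 1%N.
    move=> x z [i xi] [j zj]; exists (i + j)%N; rewrite exprDn big1 // => k _.
    have [kj|jk] := leqP j k.
      by rewrite -(subnKC kj) exprD zj mul0r mulr0 mul0rn.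
    have /subnKC <- : (i <= i + j - k)%N by lia.
    by rewrite exprD xi !mul0r mul0rn.
  by move=> a x [i xi]; exists i; rewrite exprMn xi mulr0.
(* Write g^N = u (X - c)^e with u(c) nonzero. Then [rho u] is outside [I], whose elements vanish at
   [c], while a power of X - c sends it into [I]: it is a starting point for the socle argument. *)
case: gE => N; have [e [u u0 gu]] := multiplicity_XsubC (g ^+ N) c.
rewrite expf_neq0 //= in u0.
rewrite -rmorphXn gu rmorphM rmorphXn /= mulrC => Ie.
have Iu : ~ I (rho u).
  case=> a /(congr1 (fun z => (eps z).[c])); rewrite rhoK rmorphM hornerM y1c mulr0.
  by move/eqP; exact/negP.
have [|w [Iw ws]] := ideal_socle idI Iu (s := rho ('X - c%:P) :: xs).
  move=> x; rewrite inE => /orP[/eqP->|/xs_nil[n xn]]; first by exists e.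
  by exists n; rewrite xn mul0r.
by apply: Iw; apply: y2reg; apply: (seq_ideal_kills idI ws); exact: point_gen.
Qed.

(** Depth and height are both 1 at every maximal ideal: X - c is a regular sequence at the point
    [c], and [regular_seq_size] excludes longer ones. *)
Theorem thick_line_CM (e : seq A) : (forall x, poly_span rho e x) ->
    (forall c z, rho ('X - c%:P) * z = 0 -> z = 0) ->
  cohen_macaulay A.
Proof.
move=> eA reg; split; first exact: poly_span_noetherian eA.
move=> M maxM; exists 1%N; split; last exact: maximal_height1.
have [c Mc] := maximal_point maxM; split; last first.
  by move=> s sM; apply: (@regular_seq_size c) => x /sM/Mc.
exists [:: rho ('X - c%:P)]; split=> //.
  by move=> x; rewrite inE => /eqP->; apply/Mc; exact: eps_rhoX.
split=> [/seq_ideal1[a /(congr1 (fun z => (eps z).[c]))]|[|i] //= _ y].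
  by rewrite rmorph1 rmorphM hornerM eps_rhoX mulr0 hornerC => /eqP; rewrite oner_eq0.
by move=> /seq_ideal_nil/reg->; apply/seq_ideal_nil.
Qed.

(** The height at the origin is at least 1, hence so is the depth, and some regular [y] vanishes
    there. If X killed a nonzero [z], a nonzero multiple of [z] would be killed by X and [xs], hence
    by [y]. *)
Theorem CM_thick_line_regular z : cohen_macaulay A -> rho 'X * z = 0 -> z = 0.
Proof.
move=> [_ /(_ _ (is_maximal_point 0))[n [[[s [sn s0 [_ reg]]] _] [_ hn]]]] Xz.
have n1 : (1 <= n)%N.
  have [[C Cchain] _] := maximal_height1 (is_maximal_point 0).
  exact: (hn _ C).
case: s sn s0 reg => [|y s] sn; [by rewrite -sn in n1|] => s0 reg.
have yreg u : y * u = 0 -> u = 0.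
  by move=> yu; apply/seq_ideal_nil; apply: (reg 0%N) => //; apply/seq_ideal_nil.
apply/eqP/negPn/negP => /eqP z0.
have [|w [w0 ws]] := ideal_socle (@is_ideal_zero A) z0 (s := rho ('X - 0%:P) :: xs).
  move=> x; rewrite inE => /orP[/eqP->|/xs_nil[i xi]]; last by exists i; rewrite xi mul0r.
  by exists 1%N; rewrite expr1 subr0.
apply: w0; apply: yreg; apply: (seq_ideal_kills (@is_ideal_zero A) ws).
by apply: point_gen; apply: s0; rewrite mem_head.
Qed.

End ThickLine.
(** * Orders in a numerical semigroup and in a nice gluing *)

Section SemigroupOrder.
Variables (r : nat) (d : 'I_r -> nat).
Implicit Types (a b : 'X_{1..r}) (s t : nat) (i : 'I_r).
Local Open Scope nat_scope.

Definition weight a := \sum_i a i * d i.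

(* The length of the longest factorization of s, i.e. the m-adic order of t^s;
   it is 0 if s is not in the semigroup. *)
Definition adic_order s := \max_(a : 'X_{1..r < s.+1} | weight a == s) mdeg a.

Lemma in_semigroupP s : in_semigroup d s <-> exists a, weight a = s.
Proof.
split=> [[c ->]|[a <-]]; last by exists a.
by exists [multinom c i | i < r]; apply: eq_bigr => i _; rewrite mnmE.
Qed.

Lemma weightD a b : weight (a + b)%MM = weight a + weight b.
Proof. by rewrite -big_split; apply: eq_bigr => i _; rewrite mnmDE mulnDl. Qed.

Lemma weightMn a j : weight (a *+ j)%MM = j * weight a.
Proof. by rewrite big_distrr; apply: eq_bigr => i _; rewrite mulmnE mulnAC mulnC. Qed.

Lemma weightU i : weight U_(i) = d i.
Proof.
rewrite /weight (bigD1 i) //= mnm1E eqxx mul1n big1 ?addn0 // => j.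
by rewrite mnm1E eq_sym => /negPf->.
Qed.

Lemma in_semigroup_gen i : in_semigroup d (d i).
Proof. by apply/in_semigroupP; exists U_(i)%MM; exact: weightU. Qed.

Lemma in_semigroupMn j s : in_semigroup d s -> in_semigroup d (j * s).
Proof.
move=> Ss; elim: j => [|j IH]; first by rewrite mul0n; exact: in_semigroup0.
by rewrite mulSn; exact: in_semigroupD.
Qed.

Hypothesis d_gt0 : forall i, 0 < d i.

(** Ensures that the bounded maximum in [adic_order] ranges over all factorizations. *)
Lemma mdeg_le_weight a : mdeg a <= weight a.
Proof. by rewrite mdegE; apply: leq_sum => i _; rewrite leq_pmulr. Qed.

Lemma mdeg_le_order a : mdeg a <= adic_order (weight a).
Proof.
have lt_a : mdeg a < (weight a).+1 by rewrite ltnS mdeg_le_weight.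
by rewrite /adic_order (bigD1 (BMultinom lt_a)) //= leq_maxl.
Qed.

Lemma order_attained s : in_semigroup d s -> exists2 a, weight a = s & mdeg a = adic_order s.
Proof.
case/in_semigroupP => a <-; have lt_a : mdeg a < (weight a).+1 by rewrite ltnS mdeg_le_weight.
have [|b /eqP wb Eb] := @eq_bigmax_cond _
  [pred c : 'X_{1..r < (weight a).+1} | weight c == weight a] (fun c => mdeg c).
  by apply/card_gt0P; exists (BMultinom lt_a); rewrite inE.
by exists b.
Qed.

Lemma leq_orderD s t : in_semigroup d s -> in_semigroup d t ->
  adic_order s + adic_order t <= adic_order (s + t).
Proof.
case/order_attained=> a <- <- /order_attained[b <- <-].
by rewrite -weightD -mdegD mdeg_le_order.
Qed.

Lemma leq_order_muln s t j : in_semigroup d s -> in_semigroup d t ->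
  adic_order s + j * adic_order t <= adic_order (s + j * t).
Proof.
move=> Ss St; elim: j => [|j IH]; first by rewrite !mul0n !addn0.
have Sj : in_semigroup d (s + j * t).
  by apply: in_semigroupD => //; exact: in_semigroupMn.
have -> : s + j.+1 * t = s + j * t + t by rewrite mulSn; lia.
have := leq_orderD Sj St; rewrite mulSn; lia.
Qed.

Lemma order_gt0 s : in_semigroup d s -> 0 < s -> 0 < adic_order s.
Proof.
case/in_semigroupP=> a <- wa; apply: leq_trans (mdeg_le_order a).
rewrite lt0n mdeg_eq0; apply: contraTneq wa => ->.
by rewrite /weight big1 // => i _; rewrite mnm0E.
Qed.

(** The combinatorial form of the regularity of the class of x_i on the tangent cone. *)
Definition shifts_order i := forall s,
  in_semigroup d s -> adic_order (s + d i) = (adic_order s).+1.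

Lemma shifts_order_muln i j s : shifts_order i -> in_semigroup d s ->
  adic_order (s + j * d i) = adic_order s + j.
Proof.
move=> sh Ss; elim: j => [|j IH]; first by rewrite mul0n !addn0.
have -> : s + j.+1 * d i = s + j * d i + d i by rewrite mulSn; lia.
rewrite sh ?IH ?addnS //.
by apply: in_semigroupD => //; exact/in_semigroupMn/in_semigroup_gen.
Qed.

Section Multiplicity.
Variable i0 : 'I_r.
Hypothesis d_min : forall i, i != i0 -> d i0 < d i.

(** Any generator other than [d i0] is strictly heavier, so using one pushes the weight above
    [mdeg a * d i0]. *)
Lemma weight_min_eq a j : weight a = j * d i0 -> j <= mdeg a -> a = (U_(i0) *+ j)%MM.
Proof.
move=> wa ja; have a0 i : i != i0 -> a i = 0.
  move=> ii0; apply/eqP; rewrite -leqn0 leqNgt; apply/negP => ai.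
  have : mdeg a * d i0 < weight a.
    rewrite mdegE big_distrl /weight (bigD1 i) //= [X in _ < X](bigD1 i) //=.
    rewrite -addSn; apply: leq_add; first by rewrite ltn_pmul2l // d_min.
    apply: leq_sum => i' _; have [->//|/d_min/ltnW] := eqVneq i' i0.
    by rewrite leq_mul2l => ->; rewrite orbT.
  rewrite wa ltn_pmul2r //; lia.
apply/mnmP => i; rewrite mulmnE mnm1E; have [<-|ii0] := eqVneq; last by rewrite a0 // eq_sym.
move: wa; rewrite /weight (bigD1 i0) //= big1 => [|i' /a0->//].
by rewrite addn0 => /eqP; rewrite eqn_pmul2r // mul1n => /eqP.
Qed.

Lemma order_min j : adic_order (j * d i0) = j.
Proof.
have jS : in_semigroup d (j * d i0).
  by apply/in_semigroupP; exists (U_(i0) *+ j)%MM; rewrite weightMn weightU.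
have : j <= adic_order (j * d i0).
  by have := mdeg_le_order (U_(i0) *+ j)%MM; rewrite mdegMn mdeg1 mul1n weightMn weightU.
have [a wa <-] := order_attained jS => jdeg.
by rewrite (weight_min_eq wa jdeg) mdegMn mdeg1 mul1n.
Qed.

End Multiplicity.
End SemigroupOrder.

(** * Orders in a nice gluing *)

Section GluedOrder.
Variables (l k : nat) (m : 'I_l.+1 -> nat) (n : 'I_k.+1 -> nat) (p q : nat).
Hypotheses (m_gt0 : forall i, (0 < m i)%N) (n_gt0 : forall j, (0 < n j)%N).
Hypothesis nice : nice_gluing m n p q.
Hypotheses (m_shift : shifts_order m ord0) (n_shift : shifts_order n ord0).
Local Open Scope nat_scope.
Local Notation g := (glued m n p q).

Lemma glued_gt0 i : 0 < g i.
Proof.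
have [[_ [p0 q0 _] _ _] _] := nice.
by rewrite /glued; case: split => j; rewrite muln_gt0 ?p0 ?q0 ?m_gt0 ?n_gt0.
Qed.

Lemma weight_glued (c : 'X_{1..l.+1 + k.+1}) : exists a b,
  weight g c = q * weight m a + p * weight n b /\ mdeg c = mdeg a + mdeg b.
Proof.
exists [multinom c (lshift k.+1 i) | i < l.+1], [multinom c (rshift l.+1 j) | j < k.+1].
split; last by rewrite !mdegE big_split_ord; congr addn; apply: eq_bigr => i _; rewrite mnmE.
rewrite /weight big_split_ord !big_distrr /=; congr addn; apply: eq_bigr => i _.
  by rewrite mnmE /glued (unsplitK (inl i)) mulnCA.
by rewrite mnmE /glued (unsplitK (inr i)) mulnCA.
Qed.

Lemma glued_weight (a : 'X_{1..l.+1}) (b : 'X_{1..k.+1}) :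
  exists2 c, weight g c = q * weight m a + p * weight n b & mdeg c = mdeg a + mdeg b.
Proof.
exists [multinom match split i with inl i => a i | inr j => b j end | i < l.+1 + k.+1].
  rewrite /weight big_split_ord !big_distrr /=; congr addn; apply: eq_bigr => i _.
    by rewrite mnmE /glued (unsplitK (inl i)) mulnCA.
  by rewrite mnmE /glued (unsplitK (inr i)) mulnCA.
rewrite !mdegE big_split_ord; congr addn; apply: eq_bigr => i _; rewrite mnmE.
  by rewrite (unsplitK (inl i)).
by rewrite (unsplitK (inr i)).
Qed.

Lemma in_glued u v : in_semigroup m u -> in_semigroup n v -> in_semigroup g (q * u + p * v).
Proof.
move=> /in_semigroupP[a <-] /in_semigroupP[b <-].
by apply/in_semigroupP; have [c <-] := glued_weight a b; exists c.
Qed.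

(** Stated additively, which avoids the truncated difference v - q. *)
Let apery v := in_semigroup n v /\ forall w, in_semigroup n w -> v <> w + q.

(** Since p (w + q) = p w + q p, each [q] removed from the second component becomes a [p] in the
    first; the second component decreases, so this stops in the Apery set. *)
Lemma glued_apery s : in_semigroup g s ->
  exists u v, [/\ in_semigroup m u, apery v & s = q * u + p * v].
Proof.
have [[[Sp _] [_ q0 _] _ _] _] := nice.
case/in_semigroupP=> c <-; have [a [b [-> _]]] := weight_glued c.
have: in_semigroup m (weight m a) by apply/in_semigroupP; exists a.
have: in_semigroup n (weight n b) by apply/in_semigroupP; exists b.
elim/ltn_ind: (weight n b) (weight m a) => v IH u Sv Su.
case: (pselect (exists2 w, in_semigroup n w & v = w + q)) => [[w Sw vE]|nw].
  have [||u' [v' [? ? E]]] := IH w _ (u + p) Sw; [lia|exact: in_semigroupD|].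
  exists u', v'; split=> //; rewrite -E vE; lia.
by exists u, v; split=> //; split=> // w Sw vE; apply: nw; exists w.
Qed.

(* Trading q in S2 for p in S1 never shortens a factorization, as q = a1 n1 has
   order a1, at most the order of p. *)
Lemma order_glued u v : in_semigroup m u -> apery v ->
  adic_order g (q * u + p * v) = adic_order m u + adic_order n v.
Proof.
have [[[Sp Sq] [p0 q0 pq] _ _] [b1 [a1 [pE qE a1b]]]] := nice.
move=> Su [Sv apv]; apply/eqP; rewrite eqn_leq; apply/andP; split; last first.
  have [a wa <-] := order_attained m_gt0 Su; have [b wb <-] := order_attained n_gt0 Sv.
  have [c wc <-] := glued_weight a b; rewrite -wa -wb -wc.
  by apply: mdeg_le_order; exact: glued_gt0.
have [c wc <-] := order_attained glued_gt0 (in_glued Su Sv).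
have [a [b [wab ->]]] := weight_glued c.
have Sa : in_semigroup m (weight m a) by apply/in_semigroupP; exists a.
have Sb : in_semigroup n (weight n b) by apply/in_semigroupP; exists b.
apply: leq_trans (leq_add (mdeg_le_order m_gt0 a) (mdeg_le_order n_gt0 b)) _.
rewrite wc in wab; move: (weight m a) (weight n b) Sa Sb wab => u' v' Su' Sv' E.
have p_order : a1 <= adic_order m p.
  apply: leq_trans a1b _; have := mdeg_le_order m_gt0 [multinom b1 i | i < l.+1].
  rewrite mdegE (eq_bigr b1) => [|i _]; last by rewrite mnmE.
  suff -> : weight m [multinom b1 i | i < l.+1] = p by [].
  by rewrite pE; apply: eq_bigr => i _; rewrite mnmE.
(* By coprimality [v] and [v'] differ by a multiple of [q]. If [v'] were smaller, [v] would be [q]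
   plus an element of the second semigroup, which [apv] forbids. *)
have [t vt ut] : exists2 t, v' = v + t * q & u = u' + t * p.
  have [vv'|v'v] := leqP v v'.
    have /dvdnP[t tE] : q %| v' - v.
      rewrite -(@Gauss_dvdr q p) 1?coprime_sym // mulnBr; apply/dvdnP.
      exists (u - u'); rewrite mulnBl; lia.
    exists t; first lia.
    apply/eqP; rewrite -(eqn_pmul2l q0); apply/eqP.
    have : p * v' = p * v + p * (t * q) by rewrite -mulnDr; congr muln; lia.
    rewrite mulnDr; lia.
  have /dvdnP[[|t] tE] : q %| v - v'.
    rewrite -(@Gauss_dvdr q p) 1?coprime_sym // mulnBr; apply/dvdnP.
    exists (u' - u); rewrite mulnBl; lia.
  - lia.
  - case: (apv (v' + t * q)); last by rewrite mulSn in tE; lia.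
    by apply: in_semigroupD => //; exact: in_semigroupMn.
(* Passing from [v] to [v'] gains exactly [t * a1] in order, by [n_shift], while passing from [u']
   to [u] gains at least [t] times the order of [p]. *)
have := leq_order_muln m_gt0 t Su' Sp; rewrite -ut.
have := shifts_order_muln (t * a1) n_shift Sv; rewrite -mulnA -qE -vt => ->.
have : t * a1 <= t * adic_order m p by rewrite leq_mul2l p_order orbT.
lia.
Qed.

(** Adding q m_1 changes only [u] and keeps the Apery component [v], so [order_glued] applies before
    and after. *)
Theorem shifts_order_glued : shifts_order g (lshift k.+1 ord0).
Proof.
move=> s /glued_apery[u [v [Su Av ->]]].
have -> : q * u + p * v + g (lshift k.+1 ord0) = q * (u + m ord0) + p * v.
  by rewrite /glued (unsplitK (inl _)) /= mulnDr; lia.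
rewrite !order_glued ?m_shift //.
by apply: in_semigroupD => //; exact: in_semigroup_gen.
Qed.

End GluedOrder.
(** * Hilbert function of K[[S]] *)

Section HilbertFunction.
Variables (K : fieldType) (r : nat) (d : 'I_r -> nat).
Hypothesis d_gt0 : forall i, (0 < d i)%N.
Local Notation R := (monomial_series K d).
Implicit Types (x y z : R) (s t n : nat).

Lemma series_ofP x s : series_of x s != 0 -> in_semigroup d s.
Proof. by case: x => f /= /asboolP; apply. Qed.

Lemma series_of_inj x y : (forall s, series_of x s = series_of y s) -> x = y.
Proof. by move=> xy; apply/val_inj/funext. Qed.

Lemma series_ofD x y s : series_of (x + y) s = series_of x s + series_of y s.
Proof. by []. Qed.

Lemma series_ofN x s : series_of (- x) s = - series_of x s.
Proof. by []. Qed.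

Lemma series_ofZ c x s : series_of (c *: x) s = c * series_of x s.
Proof. by []. Qed.

Lemma series_ofM x y s :
  series_of (x * y) s = \sum_(i < s.+1) series_of x i * series_of y (s - i)%N.
Proof. by []. Qed.

Lemma series_of1 s : series_of (1 : R) s = (s == 0%N)%:R.
Proof. by []. Qed.

Lemma series_of_sum (I : Type) (u : seq I) (P : pred I) (F : I -> R) s :
  series_of (\sum_(i <- u | P i) F i) s = \sum_(i <- u | P i) series_of (F i) s.
Proof.
by elim/big_rec2: _ => // i z x _ <-.
Qed.

Lemma series_ofM_neq0 x y s : series_of (x * y) s != 0 ->
  exists i j, [/\ s = (i + j)%N, series_of x i != 0 & series_of y j != 0].
Proof.
rewrite series_ofM => xy0.
have [i] : exists i : 'I_s.+1, series_of x i * series_of y (s - i)%N != 0.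
  apply/existsP; apply: contraNT xy0 => /existsPn xy0.
  by rewrite big1 // => i _; apply/eqP; rewrite -[_ == _]negbK xy0.
rewrite mulf_eq0 negb_or => /andP[xi yi]; exists i, (s - i)%N.
by rewrite subnKC // -ltnS.
Qed.

Lemma series_of0M x y : series_of (x * y) 0 = series_of x 0 * series_of y 0.
Proof. by rewrite series_ofM big_ord1. Qed.

Lemma series_ofX_lt z s j : series_of z 0 = 0 -> (s < j)%N -> series_of (z ^+ j) s = 0.
Proof.
move=> z0; elim: j s => // j IH s sj; apply/eqP/negPn/negP; rewrite exprS.
case/series_ofM_neq0 => -[|a] [b [sE]]; first by rewrite z0 eqxx.
by rewrite IH ?eqxx //; lia.
Qed.

(* The inverse of x is the geometric series in z = 1 - x / x(0), whose partial
   sums stabilize coefficientwise. *)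
Lemma nonunits_monomial_series x : nonunits x <-> series_of x 0 = 0.
Proof.
split=> [xN|x0 [y /(congr1 (fun z : R => series_of z 0))]]; last first.
  by rewrite series_of0M x0 mul0r series_of1 => /esym/eqP; rewrite oner_eq0.
apply/eqP/negPn/negP => x0; apply: xN.
set c := series_of x 0 in x0; pose z : R := 1 - c^-1 *: x.
have z0 : series_of z 0 = 0.
  by rewrite series_ofD series_ofN series_ofZ series_of1 mulVf // subrr.
pose Y N : R := c^-1 *: \sum_(j < N) z ^+ j.
have YE s N : (s < N)%N -> series_of (Y N) s = series_of (Y s.+1) s.
  move=> sN; rewrite !series_ofZ !series_of_sum 
    -(big_mkord xpredT (fun j => series_of (z ^+ j) s)).
  rewrite (big_cat_nat (n := s.+1)) //= big_mkord
    [X in _ * (_ + X)]big_nat_cond [X in _ * (_ + X)]big1 ?addr0 //.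
  by move=> j; rewrite andbT => /andP[sj _]; exact: series_ofX_lt.
have yS : monomial_series_pred d (fun s => series_of (Y s.+1) s).
  by apply/asboolP => s; exact: series_ofP.
exists (MonomialSeries yS); apply: series_of_inj => s; rewrite series_ofM.
transitivity (series_of (x * Y s.+1) s).
  by rewrite series_ofM; apply: eq_bigr => i _; rewrite (YE (s - i)%N s.+1) // ltnS leq_subr.
have -> : x * Y s.+1 = 1 - z ^+ s.+1.
  rewrite -scalerAr scalerAl -[1 in RHS](expr1n _ s.+1) subrXX.
  congr (_ * _); first by rewrite /z subKr.
  by apply: eq_bigr => i _; rewrite expr1n mul1r.
by rewrite series_ofD series_ofN series_ofX_lt // subr0.
Qed.

(** The monomial t^s, with default value 0 when [s] is not in the semigroup. *)
Definition tpow s : R := insubd 0 ((fun t => (t == s)%:R) : fps K).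

Lemma series_of_tpow s t : in_semigroup d s -> series_of (tpow s) t = (t == s)%:R.
Proof.
move=> Ss; rewrite /tpow -[series_of _]/(val _) val_insubd ifT //.
by apply/asboolP => u; case: (u =P s) => [->//|_]; rewrite eqxx.
Qed.

Lemma series_of_tpowM s x t : in_semigroup d s ->
  series_of (tpow s * x) t = if (s <= t)%N then series_of x (t - s)%N else 0.
Proof.
move=> Ss; rewrite series_ofM; case: ifP => [st|/negbT st]; last first.
  rewrite big1 // => i _; rewrite series_of_tpow //; case: eqP => [iE|_]; last by rewrite mul0r.
  by move: st (ltn_ord i); rewrite iE; lia.
have lt_s : (s < t.+1)%N by [].
rewrite (bigD1 (Ordinal lt_s)) //= series_of_tpow // eqxx mul1r big1 ?addr0 // => i.
by rewrite -val_eqE /= series_of_tpow // => /negPf->; rewrite mul0r.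
Qed.

Variable i0 : 'I_r.

(** Superadditivity of the order gives one direction; the converse distributes the exponents of [x]
    over the finitely many generators. *)
Lemma ideal_pow_monomial_series n x : ideal_pow (@nonunits R) n x <->
  forall s, series_of x s != 0 -> (n <= adic_order d s)%N.
Proof.
elim: n x => [|n IH] x; first by split.
split=> [[u uE ->] s|xn].
  rewrite series_of_sum => us.
  have [v vu] : exists2 v, v \in u & series_of (v.1 * v.2) s != 0.
    apply/hasP; apply: contraNT us => /hasPn us.
    by rewrite big_seq big1 // => v /us; rewrite negbK => /eqP.
  have [/nonunits_monomial_series v0 /IH vn] := uE v vu.
  case/series_ofM_neq0 => a [b [-> va vb]].
  apply: leq_trans (leq_orderD d_gt0 (series_ofP va) (series_ofP vb)).
  rewrite -add1n leq_add ?vn // order_gt0 //; first exact: series_ofP va.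
  by case: a va => //; rewrite v0 eqxx.
(* Removing one generator [d i] from a longest factorization of an exponent leaves order at least
   [n]. Sorting the exponents by this index [i] writes [x] as a sum of products t^(d i) times a
   series in the n-th power; [i0] is a default for exponents that do not occur. *)
have /choice[h hE] : forall s, exists i, series_of x s != 0 ->
    exists t, [/\ s = (t + d i)%N, in_semigroup d t & (n <= adic_order d t)%N].
  move=> s; have [xs|xs] := eqVneq (series_of x s) 0; first by exists i0.
  have [a wa da] := order_attained d_gt0 (series_ofP xs).
  have [i ai] : exists i, a i != 0%N.
    apply/existsP; rewrite -negb_forall; apply/negP => /forallP a0.
    have := xn s xs; rewrite -da mdegE big1 // => i _; exact/eqP/a0.
  have aE : a = (a - U_(i) + U_(i))%MM by rewrite submK // lep1mP.
  exists i => _; exists (weight d (a - U_(i))%MM); split.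
  - by rewrite -wa {1}aE weightD weightU.
  - by apply/in_semigroupP; exists (a - U_(i))%MM.
  - apply: leq_trans (mdeg_le_order d_gt0 _).
    have := xn s xs; rewrite -da {1}aE mdegD mdeg1; lia.
have gS i : monomial_series_pred d
    (fun t => if h (t + d i)%N == i then series_of x (t + d i)%N else 0).
  apply/asboolP => t; case: (h (t + d i)%N =P i) => [hi xt|_]; last by rewrite eqxx.
  by have [u []] := hE _ xt; rewrite hi => /addIn ->.
exists [seq (tpow (d i), MonomialSeries (gS i)) | i : 'I_r].
  move=> _ /mapP[i _ ->] /=; split.
    apply/nonunits_monomial_series; rewrite series_of_tpow; last exact: in_semigroup_gen.
    by rewrite eq_sym eqn0Ngt d_gt0.
  apply/IH => t /=; case: (h (t + d i)%N =P i) => [hi xt|_]; last by rewrite eqxx.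
  by have [u []] := hE _ xt; rewrite hi => /addIn ->.
rewrite big_map big_enum /=; apply: series_of_inj => s; rewrite series_of_sum.
under eq_bigr => i _ do rewrite (series_of_tpowM _ _ (in_semigroup_gen d i)) /=.
rewrite (bigD1 (h s)) //= big1 => [|i hi]; last first.
  by case: ifP => // ds; rewrite subnK // eq_sym (negPf hi).
rewrite addr0; have [xs|xs] := eqVneq (series_of x s) 0; last first.
  have [t [sE _ _]] := hE s xs; have ds : (d (h s) <= s)%N by lia.
  by rewrite ds subnK // eqxx.
by case: ifP => // ds; rewrite subnK // eqxx.
Qed.

(** By [order_bound] no element of order [n] exceeds this, so the elements of a given order form a
    finite set. *)
Let bound n := (n * \max_i d i)%N.

Let graded_exponents n : {set 'I_(bound n).+1} :=
  [set s : 'I_(bound n).+1 | `[< in_semigroup d s >] && (adic_order d s == n)].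

Lemma order_bound s : in_semigroup d s -> (s <= bound (adic_order d s))%N.
Proof.
move=> /(order_attained d_gt0)[a <- <-]; rewrite /weight /bound mdegE big_distrl.
by apply: leq_sum => i _; rewrite leq_mul2l (leq_bigmax i) orbT.
Qed.

(** The t^s with [s] of order [n] form a basis: subtracting the terms of order [n] from an element
    of the n-th power leaves only exponents of larger order. *)
Lemma hilbert_function_monomial_series :
  hilbert_function R (fun n => #|graded_exponents n|).
Proof.
move=> n; set E := graded_exponents n.
pose pos (i : 'I_#|E|) : nat := (enum_val i : 'I_(bound n).+1).
have ES (i : 'I_#|E|) : in_semigroup d (pos i) /\ adic_order d (pos i) = n.
  by have := enum_valP i; rewrite inE => /andP[/asboolP ? /eqP].
exists (fun i => tpow (pos i)).
have sumE (c : 'I_#|E| -> K) s : series_of (\sum_i c i *: tpow (pos i)) s =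
    \sum_i c i * (s == pos i)%:R.
  rewrite series_of_sum; apply: eq_bigr => i _.
  by rewrite series_ofZ series_of_tpow //; case: (ES i).
have sum_enum (c : 'I_#|E| -> K) i : series_of (\sum_i c i *: tpow (pos i)) (pos i) = c i.
  rewrite sumE (bigD1 i) //= eqxx mulr1 big1 ?addr0 // => j ji.
  by rewrite /pos val_eqE (inj_eq enum_val_inj) eq_sym (negPf ji) mulr0.
split.
- move=> i; have [Si oi] := ES i; apply/ideal_pow_monomial_series => s.
  by rewrite series_of_tpow //; case: (s =P _) => [->|_]; rewrite ?oi ?eqxx.
- move=> v /ideal_pow_monomial_series vn; exists (fun i => series_of v (pos i)).
  apply/ideal_pow_monomial_series => s ws; have Ss := series_ofP ws.
  have [sn|sn] := eqVneq (adic_order d s) n.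
    have lt_s : (s < (bound n).+1)%N by rewrite ltnS -sn order_bound.
    have sE : Ordinal lt_s \in E by rewrite inE /= sn eqxx andbT; apply/asboolP.
    have [i sval] : exists i, s = pos i.
      by exists (enum_rank_in sE (Ordinal lt_s)); rewrite /pos enum_rankK_in.
    by move: ws; rewrite series_ofD series_ofN sval sum_enum subrr eqxx.
  rewrite ltn_neqAle eq_sym sn /=; apply: vn; apply: contra ws => /eqP vs.
  rewrite series_ofD series_ofN vs sub0r oppr_eq0 sumE big1 // => i _.
  by case: (s =P _) => [si|_]; rewrite ?mulr0 //; move: sn; rewrite si;
     case: (ES i) => _ ->; rewrite eqxx.
- move=> c /ideal_pow_monomial_series cn i; apply/eqP/negPn/negP => ci.
  by have := cn (pos i); rewrite sum_enum => /(_ ci); case: (ES i) => _ ->; rewrite ltnn.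
Qed.

Theorem nondecreasing_hilbert_shifts_order : shifts_order d i0 ->
  nondecreasing_hilbert_function R.
Proof.
move=> sh; exists (fun n => #|graded_exponents n|);
  first exact: hilbert_function_monomial_series.
(* The sum stays in range for [inord], as [bound n.+1] exceeds [bound n] by the largest
   generator. *)
move=> n; pose f (s : 'I_(bound n).+1) : 'I_(bound n.+1).+1 := inord (s + d i0).
have fE (u : 'I_(bound n).+1) : f u = (u + d i0)%N :> nat.
  rewrite inordK // ltnS /bound mulSn addnC leq_add ?(leq_bigmax i0) //.
  by rewrite -ltnS; exact: ltn_ord.
rewrite -(card_imset (graded_exponents n) (f := f)); last first.
  by move=> u v fuv; apply/val_inj/(@addIn (d i0)); rewrite /= -!fE fuv.
apply: subset_leq_card; apply/subsetP => _ /imsetP[s sE ->].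
move: sE; rewrite !inE fE => /andP[/asboolP Ss /eqP os]; rewrite sh // os eqxx andbT.
by apply/asboolP/in_semigroupD => //; exact: in_semigroup_gen.
Qed.

End HilbertFunction.
(** * Tangent cone of a monomial curve *)

Section TangentConeIdeal.
Variables (K : fieldType) (r : nat) (d : 'I_r -> nat).
Hypothesis d_gt0 : forall i, (0 < d i)%N.
Local Notation P := {mpoly K[r]}.
Local Notation J := (@tangent_cone_ideal K r d).
Implicit Types (f g : P) (a b : 'X_{1..r}) (s t j : nat).

(* Separates degree ('X) and weight ('X%:P). *)
Definition bigrade : {rmorphism P -> {poly {poly K}}} :=
  mmap (polyC \o polyC) (fun i => ('X^(d i))%:P * 'X).

Lemma coef_bigradeZX c a j :
  (bigrade (c *: 'X_[a]))`_j = if mdeg a == j then c *: 'X^(weight d a) else 0.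
Proof.
have -> : bigrade (c *: 'X_[a]) = (c *: 'X^(weight d a))%:P * 'X^(mdeg a).
  rewrite /= mmapZ mmapX /mmap1 mdegE -!prodrXr -mul_polyC polyCM -mulrA; congr (_ * _).
  rewrite rmorph_prod -big_split /=; apply: eq_bigr => i _.
  by rewrite exprMn -polyC_exp mulnC exprM.
by rewrite coefCM coefXn eq_sym; case: eqP => _; rewrite ?mulr1 ?mulr0.
Qed.

Lemma coef_bigrade_sum f (D : pred 'X_{1..r}) j :
  (bigrade (\sum_(a <- msupp f | D a) f@_a *: 'X_[a]))`_j =
  \sum_(a <- msupp f | D a && (mdeg a == j)) f@_a *: 'X^(weight d a).
Proof.
rewrite rmorph_sum coef_sum [RHS]big_mkcondr; apply: eq_bigr => a _.
exact: coef_bigradeZX.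
Qed.

Lemma coef_bigrade_pihomog D f j :
  (bigrade (pihomog mdeg D f))`_j = if j == D then (bigrade f)`_j else 0.
Proof.
rewrite pihomogE coef_bigrade_sum [in RHS](mpolyE f) (coef_bigrade_sum f predT) /=.
have [->|jD] := eqVneq; first by apply: eq_bigl => a; rewrite andbb.
rewrite big1 // => a /andP[/eqP-> /eqP jE]; by rewrite jE eqxx in jD.
Qed.

Lemma bigradeE f j t :
  (bigrade f)`_j`_t = \sum_(a <- msupp f | (mdeg a == j) && (weight d a == t)) f@_a.
Proof.
rewrite [in LHS](mpolyE f) (coef_bigrade_sum f predT) coef_sum [RHS]big_mkcondr /=.
by apply: eq_bigr => a _; rewrite coefZ coefXn eq_sym; case: eqP; rewrite ?mulr1 ?mulr0.
Qed.

(* The coefficient at t^s of f in gr K[S], whose basis is S. *)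
Definition gr_coef s f := (bigrade f)`_(adic_order d s)`_s.

Lemma bigrade_neq0 f j t : (bigrade f)`_j`_t != 0 ->
  exists2 a, a \in msupp f & mdeg a = j /\ weight d a = t.
Proof.
rewrite bigradeE => f0; have /hasP[a af /andP[/eqP aj /eqP at_]] :
    has (fun a => (mdeg a == j) && (weight d a == t)) (msupp f).
  apply: contraNT f0 => /hasPn f0; rewrite big_seq_cond big1 // => a /andP[/f0/negP].
  by [].
by exists a.
Qed.

Lemma gr_coefX s a : gr_coef s 'X_[a] = ((mdeg a == adic_order d s) && (weight d a == s))%:R.
Proof. by rewrite /gr_coef bigradeE msuppX big_mkcond big_seq1 mcoeffX eqxx; case: ifP. Qed.

Lemma gr_coefE s f : gr_coef s f =
  \sum_(a <- msupp f) f@_a * ((mdeg a == adic_order d s) && (weight d a == s))%:R.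
Proof.
rewrite /gr_coef bigradeE big_mkcond; apply: eq_bigr => a _.
by case: ifP; rewrite ?mulr1 ?mulr0.
Qed.

Lemma curve_map1 a : mmap1 (fun i => 'X^(d i)) a = 'X^(weight d a) :> {poly K}.
Proof. by rewrite /mmap1 /weight -prodrXr; apply: eq_bigr => i _; rewrite mulnC exprM. Qed.

Lemma curve_mapE f s : (curve_map d f)`_s = \sum_(a <- msupp f | weight d a == s) f@_a.
Proof.
rewrite /curve_map {1}[f]mpolyE rmorph_sum coef_sum [RHS]big_mkcond /=; apply: eq_bigr => a _.
rewrite mmapZ mmapX coefCM curve_map1.
by rewrite coefXn eq_sym; case: eqP; rewrite ?mulr1 ?mulr0.
Qed.

Lemma least_degree_le f a : a \in msupp f -> (least_degree f <= mdeg a)%N.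
Proof.
rewrite /least_degree; elim: (msupp f) => // b s IH; rewrite inE big_cons.
by case/orP => [/eqP<-|/IH]; [exact: geq_minl|apply: leq_trans (geq_minr _ _)].
Qed.

Lemma least_degree_eq f a : a \in msupp f ->
  (forall b, b \in msupp f -> (mdeg a <= mdeg b)%N) ->
  least_degree f = mdeg a.
Proof.
move=> af min_a; apply/eqP; rewrite eqn_leq least_degree_le //=.
rewrite /least_degree big_seq; elim/big_ind: _ => //; first exact/ltnW/msize_mdeg_lt.
by move=> x y ax ay; rewrite leq_min ax.
Qed.

(** Only the case where [s] has order the least degree of [f] matters. A monomial of [f] of weight
    [s] then has degree at most and at least this order, so the value is the full coefficient of t^s
    on the curve, which is zero. *)
Lemma gr_coef_initial_form f s : curve_ideal d f -> gr_coef s (initial_form f) = 0.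
Proof.
move=> fI; rewrite /gr_coef coef_bigrade_pihomog; case: eqP => [sD|_]; last by rewrite coef0.
transitivity (curve_map d f)`_s; last by rewrite fI coef0.
rewrite bigradeE curve_mapE big_seq_cond [RHS]big_seq_cond; apply: eq_bigl => a.
case: (boolP (a \in msupp f)) => //= af.
case: (weight d a =P s) => [wa|]; last by rewrite andbF.
by rewrite andbT eqn_leq -{1}wa (mdeg_le_order d_gt0) sD least_degree_le.
Qed.

(** If x^a x^b has weight [s] and degree the order of [s], superadditivity forces [b] to be a
    longest factorization of its own weight. Each term of [g] thus contributes a multiple of some
    [gr_coef t f]. *)
Lemma gr_coefM s f g : (forall t, gr_coef t f = 0) -> gr_coef s (g * f) = 0.
Proof.
move=> f0; rewrite [g]mpolyE mulr_suml /gr_coef rmorph_sum !coef_sum big1 // => a _.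
have -> : bigrade (g@_a *: 'X_[a] * f) =
    (g@_a *: 'X^(weight d a))%:P * 'X^(mdeg a) * bigrade f.
  rewrite rmorphM; congr (_ * _); apply/polyP => j.
  by rewrite coef_bigradeZX coefCM coefXn eq_sym; case: eqP => _; rewrite ?mulr1 ?mulr0.
rewrite -mulrA coefCM coefXnM; case: ltnP => [_|aj]; first by rewrite mulr0 coef0.
rewrite -scalerAl coefZ coefXnM; case: ltnP => [_|as_]; first by rewrite mulr0.
apply/eqP; rewrite mulf_eq0; apply/orP; right; apply/negPn/negP => fn.
have [b bf [bj bt]] := bigrade_neq0 fn.
have St : in_semigroup d (s - weight d a) by apply/in_semigroupP; exists b.
have Sa : in_semigroup d (weight d a) by apply/in_semigroupP; exists a.
suff jt : (adic_order d s - mdeg a)%N = adic_order d (s - weight d a).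
  by move: fn; rewrite jt -/(gr_coef _ f) f0 eqxx.
have := mdeg_le_order d_gt0 b; have := leq_orderD d_gt0 St Sa.
have := mdeg_le_order d_gt0 a; rewrite subnK // bt; lia.
Qed.

Lemma gr_coefD s f g : gr_coef s (f + g) = gr_coef s f + gr_coef s g.
Proof. by rewrite /gr_coef rmorphD !coefD. Qed.

Lemma is_ideal_gr_coef : is_ideal (fun f : P => forall s, gr_coef s f = 0).
Proof.
split=> [s|f g f0 g0 s|g f f0 s]; last exact: gr_coefM.
  by rewrite /gr_coef rmorph0 !coef0.
by rewrite gr_coefD f0 g0 addr0.
Qed.

Lemma tangent_cone_gr_coef f s : J f -> gr_coef s f = 0.
Proof.
move=> Jf; move: s; move: Jf; apply: (ideal_gen_sub is_ideal_gr_coef).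
by move=> _ [f' [_ f'I ->]] s; exact: gr_coef_initial_form.
Qed.

Lemma is_ideal_tangent_cone : is_ideal J.
Proof. exact: is_ideal_gen. Qed.

(** x^a - x^b vanishes on the curve; for distinct [a] and [b] its initial form is the whole binomial
    if the degrees agree, and x^a otherwise. *)
Lemma tangent_cone_binomial a b : weight d a = weight d b -> (mdeg a <= mdeg b)%N ->
  J ('X_[a] - if mdeg b == mdeg a then 'X_[b] else 0).
Proof.
move=> wab ab; have [->|neq_ab] := eqVneq a b.
  by rewrite eqxx subrr; case: is_ideal_tangent_cone.
pose f : P := 'X_[a] - 'X_[b].
have af : a \in msupp f.
  by rewrite mcoeff_msupp mcoeffB !mcoeffX eqxx [b == a]eq_sym (negPf neq_ab) subr0 oner_neq0.
have fab c : c \in msupp f -> (mdeg a <= mdeg c)%N.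
  rewrite mcoeff_msupp mcoeffB !mcoeffX.
  by case: (a =P c) => [->//|_]; case: (b =P c) => [<-//|_]; rewrite subrr eqxx.
apply: mem_ideal_gen; exists f; split.
- by move=> f0; move: af; rewrite f0 msupp0.
- apply/polyP => s; rewrite coef0 /curve_map raddfB coefB /= !mmapX.
  by rewrite !curve_map1 wab subrr.
- by rewrite /initial_form (least_degree_eq af fab) raddfB /= !pihomogX eqxx.
Qed.

(** Modulo [J] a monomial equals the chosen longest factorization [rep s] of its weight if it is
    itself longest, and 0 otherwise. So [f] reduces to the combination of the x^(rep s) with
    coefficients [gr_coef s f]. *)
Lemma gr_coef_tangent_cone f : (forall s, gr_coef s f = 0) -> J f.
Proof.
move=> f0; have [J0 JD JM] := is_ideal_tangent_cone.
have /choice[rep repP] : forall s, exists a,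
    in_semigroup d s -> weight d a = s /\ mdeg a = adic_order d s.
  move=> s; case: (pselect (in_semigroup d s)) => [Ss|nS]; last by exists 0%MM.
  by have [a] := order_attained d_gt0 Ss; exists a.
(* Exceeds every weight in [f], so that the sum over [s] below is finite. *)
pose B := (\max_(a <- msupp f) weight d a).+1.
pose cond a s := (mdeg a == adic_order d s) && (weight d a == s).
have fE : f = \sum_(a <- msupp f) f@_a *: ('X_[a] - \sum_(s < B) (cond a s)%:R *: 'X_[rep s]).
  under eq_bigr => a _ do rewrite scalerBr.
  rewrite sumrB -mpolyE.
  under [X in _ - X]eq_bigr => a _ do rewrite scaler_sumr.
  rewrite exchange_big big1 ?subr0 //= => s _.
  under eq_bigr => a _ do rewrite scalerA.
  by rewrite -scaler_suml -gr_coefE f0 scale0r.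
rewrite fE big_seq; elim/big_ind: _ => // a af; rewrite -mul_mpolyC; apply: JM.
have wB : (weight d a < B)%N by rewrite ltnS (bigD1_seq a) //= leq_maxl.
have [wr dr] : weight d (rep (weight d a)) = weight d a /\
    mdeg (rep (weight d a)) = adic_order d (weight d a).
  by apply: repP; apply/in_semigroupP; exists a.
rewrite (bigD1 (Ordinal wB)) //= [X in _ - (_ + X)]big1 => [|s]; last first.
  by rewrite -val_eqE /= /cond eq_sym => /negPf->; rewrite andbF scale0r.
have := @tangent_cone_binomial a (rep (weight d a)); rewrite wr dr.
rewrite (mdeg_le_order d_gt0) => /(_ erefl isT); rewrite /cond eqxx andbT addr0 eq_sym.
by case: eqP => _; rewrite ?scale1r ?scale0r.
Qed.

End TangentConeIdeal.

(** * The tangent cone ring as a thick line *)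

Section TangentConeRing.
Variables (K : fieldType) (r : nat) (d : 'I_r -> nat).
Hypothesis d_gt0 : forall i, (0 < d i)%N.
Variable i0 : 'I_r.
Hypothesis d_min : forall i, i != i0 -> (d i0 < d i)%N.
Local Notation P := {mpoly K[r]}.
Local Notation T := (tangent_cone_ring K d_gt0).
Local Notation Q := {ideal_quot (tangent_cone_pred d_gt0 : idealr P)}.
Implicit Types (f g : P) (a b : 'X_{1..r}) (s t j : nat).

Definition cone_class : {rmorphism P -> T} := \pi_Q%qT.

Lemma cone_class_eq0 f : cone_class f = 0 <-> forall s, gr_coef d s f = 0.
Proof.
have E : `[< tangent_cone_ideal d f >] = (cone_class f == 0).
  have := @Quotient.idealrBE _ (tangent_cone_pred d_gt0 : idealr P) f 0.
  by rewrite subr0 unfold_in -(rmorph0 cone_class); exact.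
split=> [/eqP f0 s|f0].
  by apply: (tangent_cone_gr_coef d_gt0); apply/asboolP; rewrite E.
by apply/eqP; rewrite -E; apply/asboolP; exact: gr_coef_tangent_cone.
Qed.

Lemma cone_class_surj (u : T) : exists f, cone_class f = u.
Proof. by exists (repr (u : Q)); exact: reprK. Qed.

Lemma cone_classX_eq0 a : cone_class 'X_[a] = 0 <-> mdeg a <> adic_order d (weight d a).
Proof.
rewrite cone_class_eq0; split=> [a0 aE|aE s].
  by have := a0 (weight d a); rewrite gr_coefX aE !eqxx => /eqP; rewrite oner_eq0.
by rewrite gr_coefX; case: (weight d a =P s) => [<-|_]; rewrite ?andbF ?andbT //; case: eqP.
Qed.

Definition axis_eval : {rmorphism P -> {poly K}} :=
  mmap (@polyC K) (fun i => if i == i0 then 'X else 0).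

(** The power x_{i0}^j is the only monomial of weight [j * d i0] whose degree is the order [j] of
    that weight. Hence [axis_eval] factors through the tangent cone ring. *)
Lemma coef_axis_eval f j : (axis_eval f)`_j = gr_coef d (j * d i0) f.
Proof.
rewrite {1}[f]mpolyE rmorph_sum coef_sum gr_coefE; apply: eq_bigr => a _.
rewrite /= mmapZ mmapX coefCM (order_min d_gt0 d_min); congr (_ * _).
have [-> | aj] := eqVneq a (U_(i0) *+ j)%MM.
  rewrite mdegMn mdeg1 mul1n weightMn weightU !eqxx /mmap1 (bigD1 i0) //= eqxx.
  rewrite big1 => [|i /negPf ii0]; rewrite mulmnE mnm1E.
    by rewrite eqxx mul1n mulr1 coefXn eqxx.
  by rewrite [i0 == i]eq_sym ii0 mul0n expr0.
have -> : (mdeg a == j) && (weight d a == j * d i0)%N = false.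
  apply: contraNF aj => /andP[/eqP ja /eqP wa]; apply/eqP.
  by apply: (weight_min_eq d_gt0 d_min wa); rewrite ja.
rewrite /mmap1 (bigD1 i0) //= eqxx.
have [/existsP[i /andP[ii0 ai]]|/existsPn a0] := boolP [exists i, (i != i0) && (a i != 0%N)].
  by rewrite (bigD1 i) //= (negPf ii0) expr0n (negPf ai) mul0r mulr0 coef0.
rewrite big1 => [|i ii0]; last first.
  by have := a0 i; rewrite ii0 negbK => /eqP->; rewrite expr0.
rewrite mulr1 coefXn; case: eqP => // jE; case/eqP: aj; apply/mnmP => i.
rewrite mulmnE mnm1E; have [<-|ii0] := eqVneq i0 i; first by rewrite jE mul1n.
by have := a0 i; rewrite eq_sym ii0 negbK => /eqP->.
Qed.

Lemma axis_eval_ker f : cone_class f = 0 -> axis_eval f = 0.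
Proof.
by move=> /cone_class_eq0 f0; apply/polyP => j; rewrite coef_axis_eval f0 coef0.
Qed.

(** Computed on a representative; [cone_eps_funE] shows that the choice is irrelevant. *)
Definition cone_eps_fun (u : T) : {poly K} := axis_eval (repr (u : Q)).

Lemma cone_eps_funE f : cone_eps_fun (cone_class f) = axis_eval f.
Proof.
apply/eqP; rewrite -subr_eq0 -rmorphB; apply/eqP/axis_eval_ker.
by rewrite rmorphB; apply/eqP; rewrite subr_eq0; apply/eqP; exact: reprK.
Qed.

Fact cone_eps_zmod_morphism : zmod_morphism cone_eps_fun.
Proof.
move=> u v; have [f <-] := cone_class_surj u; have [g <-] := cone_class_surj v.
by rewrite -rmorphB !cone_eps_funE rmorphB.
Qed.

Fact cone_eps_monoid_morphism : monoid_morphism cone_eps_fun.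
Proof.
split; first by rewrite -(rmorph1 cone_class) cone_eps_funE rmorph1.
move=> u v; have [f <-] := cone_class_surj u; have [g <-] := cone_class_surj v.
by rewrite -rmorphM !cone_eps_funE rmorphM.
Qed.

HB.instance Definition _ :=
  GRing.isZmodMorphism.Build T {poly K} cone_eps_fun cone_eps_zmod_morphism.
HB.instance Definition _ :=
  GRing.isMonoidMorphism.Build T {poly K} cone_eps_fun cone_eps_monoid_morphism.

Definition cone_eps : {rmorphism T -> {poly K}} := cone_eps_fun.

Lemma cone_epsE f : cone_eps (cone_class f) = axis_eval f.
Proof. exact: cone_eps_funE. Qed.

Fact cone_rho_comm : commr_rmorph (cone_class \o @mpolyC r K) (cone_class 'X_i0).
Proof. by move=> c; exact: mulrC. Qed.

Definition cone_rho : {rmorphism {poly K} -> T} := horner_morph cone_rho_comm.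

Lemma cone_rhoX : cone_rho 'X = cone_class 'X_i0.
Proof. exact: horner_morphX. Qed.

Lemma cone_rhoC c : cone_rho c%:P = cone_class c%:MP.
Proof. exact: horner_morphC. Qed.

Lemma axis_evalX i : axis_eval 'X_i = if i == i0 then 'X else 0.
Proof. by rewrite /= mmapX mmap1U. Qed.

Lemma cone_rhoK : cancel cone_rho cone_eps.
Proof.
elim/poly_ind => [|p c IH]; first by rewrite !rmorph0.
rewrite !rmorphD !rmorphM /= IH cone_rhoX cone_rhoC !cone_epsE axis_evalX eqxx.
by rewrite /= mmapC.
Qed.

Definition cone_nilpotents : seq T :=
  [seq cone_class 'X_i | i <- enum 'I_r & i != i0].

(** The weight [d i0 * d i] is also reached by [d i] copies of [d i0], a longer factorization since
    [d i0 < d i]. *)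
Lemma cone_classX_exp_eq0 i : i != i0 -> cone_class 'X_i ^+ d i0 = 0.
Proof.
move=> ii0; rewrite -rmorphXn mpolyXn; apply/cone_classX_eq0.
rewrite mdegMn mdeg1 mul1n weightMn weightU mulnC order_min // => E.
by have := d_min ii0; rewrite -E ltnn.
Qed.

Lemma cone_nilpotentsP u : u \in cone_nilpotents -> exists n, u ^+ n = 0.
Proof.
case/mapP => i; rewrite mem_filter => /andP[ii0 _] ->; exists (d i0).
exact: cone_classX_exp_eq0.
Qed.

(** The property is stable under sums and products, and holds for constants and variables. *)
Lemma cone_eps_ker u : seq_ideal cone_nilpotents (u - cone_rho (cone_eps u)).
Proof.
have idN := is_ideal_gen (fun x => x \in cone_nilpotents); have [N0 ND NM] := idN.
pose good u := seq_ideal cone_nilpotents (u - cone_rho (cone_eps u)).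
have goodD v w : good v -> good w -> good (v + w).
  by rewrite /good !rmorphD opprD addrACA; exact: ND.
have goodM v w : good v -> good w -> good (v * w).
  move=> gv gw; rewrite /good !rmorphM /=.
  have -> : v * w - cone_rho (cone_eps v) * cone_rho (cone_eps w) =
    w * (v - cone_rho (cone_eps v)) +
    cone_rho (cone_eps v) * (w - cone_rho (cone_eps w)) by ring.
  by apply: ND; exact: NM.
have goodC c : good (cone_class c%:MP) by rewrite /good -cone_rhoC cone_rhoK subrr.
have goodX i : good (cone_class 'X_i).
  rewrite /good cone_epsE axis_evalX; have [->|ii0] := eqVneq.
    by rewrite cone_rhoX subrr.
  rewrite rmorph0 subr0; apply: mem_ideal_gen; apply: map_f.
  by rewrite mem_filter ii0 mem_enum.
have [f <-] := cone_class_surj u; rewrite -/(good _) [f]mpolyE rmorph_sum.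
have good0 : good 0 by rewrite -(rmorph0 cone_class) -mpolyC0; exact: goodC.
have good1 : good 1 by rewrite -(rmorph1 cone_class) -mpolyC1; exact: goodC.
elim/big_ind: _ => [||a _]; [exact: good0|exact: goodD|].
rewrite -mul_mpolyC rmorphM; apply: (goodM _ _ (goodC _)).
rewrite mpolyXE_id rmorph_prod; elim/big_ind: _ => [||i _]; [exact: good1|exact: goodM|].
rewrite rmorphXn; elim: (a i) => [|j IH]; last by rewrite exprS; apply: goodM.
by [].
Qed.

(** A spanning family over [{poly K}]: the degree bound admits every monomial with all exponents
    below [d i0]. *)
Definition cone_basis : seq T :=
  [seq cone_class 'X_[bmnm a] | a : 'X_{1..r < (r * d i0).+1}].

Lemma cone_basis_span u : poly_span cone_rho cone_basis u.
Proof.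
have [f <-] := cone_class_surj u; rewrite [f]mpolyE rmorph_sum.
elim/big_ind: _ => [||a _]; [exact: poly_span0|exact: poly_spanD|].
(* The power of x_{i0} goes into the scalar; the remaining monomial is 0 as soon as one exponent
   reaches [d i0]. *)
pose a' := [multinom (if i == i0 then 0 else a i)%N | i < r].
have aE : a = (U_(i0) *+ a i0 + a')%MM.
  apply/mnmP => i; rewrite mnmDE mulmnE mnm1E mnmE eq_sym.
  by have [->|_] := eqVneq i i0; rewrite ?mul1n ?addn0 ?mul0n.
rewrite aE -mul_mpolyC mpolyXD -mpolyXn !rmorphM rmorphXn /= -cone_rhoC -cone_rhoX.
rewrite -rmorphXn mulrA -rmorphM; apply: poly_spanZ.
have [/existsP[i]|/existsPn small] := boolP [exists i, d i0 <= a' i]%N.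
  rewrite mnmE; have [|ii0 da] := eqVneq; first by rewrite leqNgt d_gt0.
  have -> : a' = (U_(i) *+ d i0 + (a' - U_(i) *+ d i0))%MM.
    apply/mnmP => i'; rewrite mnmDE mnmBE mulmnE mnm1E.
    have [<-|] := eqVneq i i'; last by rewrite mul0n subn0.
    by rewrite mul1n subnKC // mnmE (negPf ii0).
  by rewrite mpolyXD -mpolyXn rmorphM rmorphXn /= cone_classX_exp_eq0 // mul0r; exact: poly_span0.
have a'B : (mdeg a' < (r * d i0).+1)%N.
  rewrite ltnS mdegE -[X in (_ <= X * _)%N]card_ord -sum_nat_const; apply: leq_sum => i _.
  by rewrite ltnW // ltnNge.
by apply: poly_span_mem; apply/mapP; exists (BMultinom a'B); rewrite ?mem_enum.
Qed.

Lemma gr_coefXM s f : shifts_order d i0 -> gr_coef d s f != 0 ->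
  gr_coef d (s + d i0) ('X_i0 * f) = gr_coef d s f.
Proof.
move=> sh f0; have [a _ [_ wa]] := bigrade_neq0 f0.
have Ss : in_semigroup d s by apply/in_semigroupP; exists a.
rewrite /gr_coef sh //.
have -> : bigrade K d ('X_i0 * f) = bigrade K d f * ('X^(d i0))%:P * 'X.
  by rewrite rmorphM /= mmapX mmap1U mulrC mulrA.
by rewrite coefMX /= coefMC coefMXn ltnNge leq_addl /= addnK.
Qed.

(** A top-term argument: if [t] is the largest weight at which [f] has a nonzero coefficient, then
    at [t + d i0] the product has that same coefficient, since the term with [c] contributes nothing
    there. *)
Lemma cone_rho_regular c u : shifts_order d i0 -> cone_rho ('X - c%:P) * u = 0 -> u = 0.
Proof.
move=> sh; have [f <-] := cone_class_surj u.
rewrite rmorphB cone_rhoX cone_rhoC -rmorphB -rmorphM => /cone_class_eq0 f0.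
apply/cone_class_eq0 => s; apply/eqP/negPn/negP => fs.
have bounded t : gr_coef d t f != 0 -> (t <= \max_(a <- msupp f) weight d a)%N.
  by case/bigrade_neq0 => a af [_ <-]; rewrite (bigD1_seq a) //= leq_maxl.
have [t ft tmax] := ex_maxnP (ex_intro (fun s => gr_coef d s f != 0) s fs) bounded.
have ft' : gr_coef d (t + d i0) f = 0.
  apply/eqP/negPn/negP => /tmax; have := d_gt0 i0; lia.
have := f0 (t + d i0)%N; rewrite mulrBl gr_coefD gr_coefXM //.
rewrite -mulNr -rmorphN; have -> g t' (b : K) : gr_coef d t' (b%:MP * g) = b * gr_coef d t' g.
  by rewrite /gr_coef rmorphM /= mmapC /= !coefCM.
by rewrite ft' mulr0 addr0 => /eqP; apply/negP.
Qed.

(** A longest factorization of [s] has nonzero class. By regularity its product with x_{i0} does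
    too, and is therefore a longest factorization of [s + d i0]. *)
Theorem regular_shifts_order :
  (forall u : T, cone_rho 'X * u = 0 -> u = 0) -> shifts_order d i0.
Proof.
move=> reg s Ss; have [a wa da] := order_attained d_gt0 Ss.
have a0 : cone_class 'X_[a] <> 0 by rewrite cone_classX_eq0 wa da.
have : ~ cone_class 'X_[U_(i0) + a] = 0.
  by rewrite mpolyXD rmorphM -cone_rhoX => /reg.
rewrite cone_classX_eq0 mdegD mdeg1 weightD weightU wa da add1n addnC.
by case: (eqVneq (adic_order d s).+1 (adic_order d (s + d i0))) => // /eqP ne /(_ ne).
Qed.

End TangentConeRing.

(** * The Cohen-Macaulay criterion and its application to nice gluings *)

Lemma CM_tangent_coneP (K : closedFieldType) (r : nat) (d : 'I_r -> nat) (i0 : 'I_r) :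
    (forall i, (0 < d i)%N) -> (forall i, i != i0 -> (d i0 < d i)%N) ->
  CM_tangent_cone K d <-> shifts_order d i0.
Proof.
move=> d_gt0 d_min; split=> [[d_gt0' CM]|sh].
  apply: (@regular_shifts_order K r d d_gt0' i0) => u Xu.
  exact: (CM_thick_line_regular (cone_rhoK d_gt0' d_min) (cone_nilpotentsP d_min)
    (cone_eps_ker d_min) CM Xu).
exists d_gt0; apply: (thick_line_CM (cone_rhoK d_gt0 d_min) (cone_nilpotentsP d_min)
  (cone_eps_ker d_min) (cone_basis_span d_min)).
by move=> c u; exact: cone_rho_regular.
Qed.

Theorem theorem2p6 (K : closedFieldType) (l k : nat)
    (m : 'I_l.+1 -> nat) (n : 'I_k.+1 -> nat) (p q : nat)
    (m_gen : minimal_generators m) (n_gen : minimal_generators n)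
    (m_incr : forall i j : 'I_l.+1, (i < j)%N -> (m i < m j)%N)
    (n_incr : forall i j : 'I_k.+1, (i < j)%N -> (n i < n j)%N)
    (nice : nice_gluing m n p q)
    (CM_m : CM_tangent_cone K m) (CM_n : CM_tangent_cone K n) :
  CM_tangent_cone K (glued m n p q) /\
  nondecreasing_hilbert_function (monomial_series K (glued m n p q)).
Proof.
have [m_gt0 _ _] := m_gen; have [n_gt0 _ _] := n_gen.
have m_min i : i != ord0 -> (m ord0 < m i)%N by move=> i0; apply: m_incr; rewrite lt0n.
have n_min i : i != ord0 -> (n ord0 < n i)%N by move=> i0; apply: n_incr; rewrite lt0n.
have sh : shifts_order (glued m n p q) (lshift k.+1 ord0).
  by apply: shifts_order_glued => //; [exact/(CM_tangent_coneP K m_gt0 m_min)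
    |exact/(CM_tangent_coneP K n_gt0 n_min)].
have g_gt0 := glued_gt0 m_gt0 n_gt0 nice.
split; last exact: nondecreasing_hilbert_shifts_order sh.
apply/(@CM_tangent_coneP K _ _ (lshift k.+1 ord0)) => // i.
have [[_ [p0 q0 _] _ disj] [b [a1 [pE qE a1b]]]] := nice.
rewrite /glued (unsplitK (inl _)) /=; case: splitP => j ij ne.
  rewrite ltn_pmul2l //; apply: m_min; apply: contraNneq ne => j0.
  by apply/eqP/val_inj; rewrite /= ij j0.
(* Niceness makes q m_1 the smallest generator: q m_1 = a_1 n_1 m_1 is at most (b_1 + ... + b_l) m_1
   n_1, which is at most p n_1 and so at most p n_j. Disjointness of the two generating sets makes
   this strict. *)
rewrite ltn_neqAle; apply/andP; split; first exact/eqP.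
have n0 : (n ord0 <= n j)%N by have [->//|/n_min/ltnW] := eqVneq j ord0.
apply: leq_trans (_ : (p * n ord0 <= _)%N); last by rewrite leq_mul2l n0 orbT.
rewrite qE mulnAC leq_mul2r; apply/orP; right.
rewrite pE; apply: leq_trans (_ : (\sum_i b i) * m ord0 <= _)%N.
  by rewrite leq_mul2r a1b orbT.
rewrite big_distrl; apply: leq_sum => i' _; rewrite leq_mul2l.
by have [->|/m_min/ltnW->] := eqVneq i' ord0; rewrite ?leqnn orbT.
Qed.
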